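(* Let $K\colon(-\infty,0)\cup(0,\infty)\to\mathbb{R}$ be a monotone kernel function. Let $n\in\mathbb{N}$, let $r_1,\ldots,r_n>0$ be arbitrary, and define $R:=r_1+\ldots+r_n$. Assume that $J\colon\mathbb{R}\to\mathbb{R}\cup\{-\infty\}$ is an $R$-admissible $n$-field function for $K$. Consider the sum of translates function $F(\mathbf{y},t)=J(t)+\sum_{j=1}^n r_jK(t-y_j)$. Then $$M(\overline{S^{\infty}})=m(\overline{S^{\infty}}),$$ and there exists some point $\mathbf{w}\in\overline{S^{\infty}}$ such that $\overline{m}(\mathbf{w})=M(\overline{S^{\infty}})$. Furthermore, there are no $\mathbf{x},\mathbf{y}\in\overline{S^{\infty}}$ with all of $m_j(\mathbf{x}),m_j(\mathbf{y})$, $j=0,\ldots,n$, finite such that $$m_j(\mathbf{x})>m_j(\mathbf{y}),\quad j=0,\ldots,n.$$ If there exists an equioscillation point $\mathbf{e}$ on $\mathbb{R}$, then it is a minimax and maximin point, i.e., $$M(\overline{S^{\infty}})=\overline{m}(\mathbf{e})=\underline{m}(\mathbf{e})=m(\overline{S^{\infty}}).$$ Additionally: (1) If $J$ is upper semicontinuous or $K$ is singular, then there exists an equioscillation point on $\mathbb{R}$. (2) If $K$ is singular and strictly concave (on each of $(-\infty,0)$ and $(0,\infty)$), then the equioscillation point is unique. Moreover, the intertwining property holds: there are no $\mathbf{x}\neq\mathbf{y}$ in $\overline{S^{\infty}}$ with all of $m_j(\mathbf{x}),m_j(\mathbf{y})$ finite such that $m_j(\mathbf{x})\ge m_j(\mathbf{y})$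 for all $j=0,\ldots,n$. In particular, the equioscillation point is the unique minimax point (the unique $\mathbf{y}\in\overline{S^{\infty}}$ with $\overline{m}(\mathbf{y})=M(\overline{S^{\infty}})$) and the unique maximin point (the unique $\mathbf{y}\in\overline{S^{\infty}}$ with $\underline{m}(\mathbf{y})=m(\overline{S^{\infty}})$).
   Context: A kernel function (on $\mathbb{R}$) is a function $K\colon(-\infty,0)\cup(0,\infty)\to\mathbb{R}$ that is concave on $(-\infty,0)$ and concave on $(0,\infty)$ and satisfies $\lim_{t\downarrow0}K(t)=\lim_{t\uparrow0}K(t)$, this common limit being real or $-\infty$; one sets $K(0):=\lim_{t\to0}K(t)\in\mathbb{R}\cup\{-\infty\}$. $K$ is monotone if it is decreasing on $(-\infty,0)$ and increasing on $(0,\infty)$ (in the non-strict sense). $K$ is singular if $K(0)=-\infty$. An (external) $n$-field function on $\mathbb{R}$ is a function $J\colon\mathbb{R}\to\mathbb{R}\cup\{-\infty\}$ that is bounded above and takes finite values at more than $n$ different points. For $R>0$, $J$ is $R$-admissible for $K$ if $\lim_{|t|\to\infty}(J(t)+RK(t))=-\infty$. $\overline{S^{\infty}}:=\{\mathbf{y}=(y_1,\ldots,y_n)\colon-\infty<y_1\le y_2\le\ldots\le y_n<\infty\}$. For $\mathbf{y}\in\overline{S^{\infty}}$ and $t\in\mathbb{R}$, $F(\mathbf{y},t)=J(t)+\sum_{j=1}^n r_jK(t-y_j)\in\mathbb{R}\cup\{-\infty\}$. Set $m_0(\mathbf{y}):=\sup_{t\in(-\infty,y_1]}F(\mathbf{y},t)$,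 $m_n(\mathbf{y}):=\sup_{t\in[y_n,\infty)}F(\mathbf{y},t)$, $m_j(\mathbf{y}):=\sup_{t\in[y_j,y_{j+1}]}F(\mathbf{y},t)$ for $j=1,\ldots,n-1$; $\overline{m}(\mathbf{y}):=\max_{0\le j\le n}m_j(\mathbf{y})=\sup_{t\in\mathbb{R}}F(\mathbf{y},t)$, $\underline{m}(\mathbf{y}):=\min_{0\le j\le n}m_j(\mathbf{y})$; $M(\overline{S^{\infty}}):=\inf_{\mathbf{y}\in\overline{S^{\infty}}}\overline{m}(\mathbf{y})$, $m(\overline{S^{\infty}}):=\sup_{\mathbf{y}\in\overline{S^{\infty}}}\underline{m}(\mathbf{y})$. A point $\mathbf{y}\in\overline{S^{\infty}}$ is an equioscillation point on $\mathbb{R}$ if $m_0(\mathbf{y})=m_1(\mathbf{y})=\ldots=m_n(\mathbf{y})$. *)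

(* Defs.v *)
From mathcomp Require Import all_boot all_order all_algebra.
From mathcomp Require Import all_classical all_reals all_analysis.

Set Implicit Arguments.
Unset Strict Implicit.
Unset Printing Implicit Defensive.

Import Order.TTheory GRing.Theory Num.Theory.
Import numFieldNormedType.Exports.

Local Open Scope classical_set_scope.
Local Open Scope ring_scope.

(* A kernel (-oo, 0) `|` (0, +oo) -> R is represented by a total K : R -> R
   whose value at 0 is never used: every definition below only looks at K on
   the punctured line, and K(0) is the limit kernel0 K. *)

Definition concave_on (R : realType) (D : set R) (f : R -> R) : Prop :=
  convex_function (D : set R^o) (fun t => - f t).

Definition strictly_concave_on (R : realType) (D : set R) (f : R -> R) : Prop :=
  forall x y a : R, D x -> D y -> x != y -> 0 < a -> a < 1 ->
    a * f x + (1 - a) * f y < f (a * x + (1 - a) * y).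

Definition kernel_function (R : realType) (K : R -> R) : Prop :=
  [/\ concave_on `]-oo, 0[ K, concave_on `]0, +oo[ K &
   exists l : \bar R,
     [/\ l != +oo%E, (K t)%:E @[t --> 0^'+] --> l
       & (K t)%:E @[t --> 0^'-] --> l]].

Definition kernel0 (R : realType) (K : R -> R) : \bar R :=
  lim ((K t)%:E @[t --> 0^']).

Definition ext_kernel (R : realType) (K : R -> R) (t : R) : \bar R :=
  if t == 0 then kernel0 K else (K t)%:E.

Definition monotone_kernel (R : realType) (K : R -> R) : Prop :=
  (forall s t : R, s <= t -> t < 0 -> K t <= K s) /\
  (forall s t : R, 0 < s -> s <= t -> K s <= K t).

Definition singular_kernel (R : realType) (K : R -> R) : Prop :=
  kernel0 K = -oo%E.

Definition strictly_concave_kernel (R : realType) (K : R -> R) : Prop :=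
  strictly_concave_on `]-oo, 0[ K /\ strictly_concave_on `]0, +oo[ K.

(* The real upper bound C also excludes the value +oo. *)
Definition field_function (R : realType) (n : nat) (J : R -> \bar R) : Prop :=
  (exists C : R, forall t, (J t <= C%:E)%E) /\
  (exists s : seq R,
     [/\ uniq s, (n < size s)%N & forall t, t \in s -> J t \is a fin_num]).

Definition admissible (R : realType) (rho : R) (K : R -> R) (J : R -> \bar R)
    : Prop :=
  (J t + rho%:E * ext_kernel K t)%E @[t --> -oo%R] --> -oo%E /\
  (J t + rho%:E * ext_kernel K t)%E @[t --> +oo%R] --> -oo%E.

Definition upper_semicontinuous (R : realType) (J : R -> \bar R) : Prop :=
  lower_semicontinuous (fun t => - J t)%E.

Definition Sbar (R : realType) (n : nat) : set (n.-tuple R) :=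
  [set y : n.-tuple R | sorted <=%R y].

(* The points y_1 <= ... <= y_n are the entries y`_0, ..., y`_(n.-1), so y_j is
   y`_(j.-1); cell y 0 = (-oo, y_1], cell y n = [y_n, +oo), and
   cell y j = [y_j, y_(j+1)] otherwise. *)
Definition cell (R : realType) (n : nat) (y : n.-tuple R) (j : nat) : set R :=
  [set t | ((0 < j)%N -> y`_j.-1 <= t) /\ ((j < n)%N -> t <= y`_j)].

Section SumOfTranslates.
Variables (R : realType) (K : R -> R) (n : nat) (r : 'I_n -> R).
Variable J : R -> \bar R.
Implicit Types (y : n.-tuple R) (j : nat).

Definition sum_of_translates y (t : R) : \bar R :=
  (J t + \sum_(i < n) (r i)%:E * ext_kernel K (t - tnth y i))%E.

Definition int_max y j : \bar R :=
  ereal_sup [set sum_of_translates y t | t in cell y j].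

Definition max_max y : \bar R := \big[maxe/-oo%E]_(j < n.+1) int_max y j.

Definition min_max y : \bar R := \big[mine/+oo%E]_(j < n.+1) int_max y j.

Definition minimax_value : \bar R :=
  ereal_inf [set max_max y | y in @Sbar R n].

Definition maximin_value : \bar R :=
  ereal_sup [set min_max y | y in @Sbar R n].

Definition minimax_point y : Prop := Sbar y /\ max_max y = minimax_value.

Definition maximin_point y : Prop := Sbar y /\ min_max y = maximin_value.

Definition equioscillation_point y : Prop :=
  Sbar y /\ forall i j : 'I_n.+1, int_max y i = int_max y j.

Definition int_max_finite y : Prop :=
  forall j : 'I_n.+1, int_max y j \is a fin_num.

End SumOfTranslates.

(* Main.v *)
Require Import Defs.
From mathcomp Require Import all_boot all_order all_algebra.
From mathcomp Require Import all_classical all_reals all_analysis.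
From mathcomp Require Import ring lra zify.

(** Everything rests on one pointwise comparison. Given nondecreasing x and y, put
    D_l = sum_(i < l) r_i (x_i - y_i) and let j maximize D over 0, ..., n. Then the j-th cell of
    x is contained in that of y, and, by supporting lines of K and Abel summation,
    F(x, .) <= F(y, .) on it; hence m_j(x) <= m_j(y). This excludes strict majorization, gives
    m <= M, and forces an equioscillation point to be minimax and maximin; the inequality is
    strict where F(x, .) is finite when x <> y and K is strictly concave.

    For J upper semicontinuous, Jensen's inequality shows that the superlevel sets of the
    smallest local maximum are bounded, so a maximizer w exists. If K is strictly concave, w
    equioscillates: otherwise decrease D slightly, exactly at the indices where m_j(w) is
    minimal; the comparison raises those m_j, and the others move by little. A general K is
    approximated uniformly by the strictly concave kernels K - e / (1 + |t|). A general J is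
    replaced by its upper semicontinuous envelope, which changes no m_j when K is singular,
    and in general does not change the maximin value, because the nodes can be moved slightly
    so that J almost attains its envelope at them. *)

Set Implicit Arguments.
Unset Strict Implicit.
Unset Printing Implicit Defensive.

Import Order.TTheory GRing.Theory Num.Theory.
Import numFieldNormedType.Exports.

Local Open Scope classical_set_scope.
Local Open Scope ring_scope.

(** * Limits in the extended reals and along ultrafilters *)

Section ErealLimits.
Variables (R : realType) (T : Type) (F : set_system T).
Hypothesis FF : Filter F.
Implicit Types (f : T -> \bar R) (x y l c : \bar R).

Lemma cvge_near_gt f l c : f @ F --> l -> (c < l)%E -> \forall t \near F, (c < f t)%E.
Proof.
move=> fl cl; apply: (fl [set y | (c < y)%E]); apply: open_nbhs_nbhs; split => //.
exact: open_ereal_gt_ereal.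
Qed.

Lemma cvge_near_lt f l c : f @ F --> l -> (l < c)%E -> \forall t \near F, (f t < c)%E.
Proof.
move=> fl cl; apply: (fl [set y | (y < c)%E]); apply: open_nbhs_nbhs; split => //.
exact: open_ereal_lt_ereal.
Qed.

(** Limits equal to -oo are harmless here: only a sum of +oo and -oo could break the passage to the
    limit, and +oo is excluded. *)
Lemma cvge_sum_lty (I : Type) (s : seq I) (f : I -> T -> \bar R) (l : I -> \bar R) :
  (forall i, (l i < +oo)%E) -> (forall i, f i @ F --> l i) ->
  (\sum_(i <- s) f i t)%E @[t --> F] --> (\sum_(i <- s) l i)%E.
Proof.
move=> llty fl; elim: s => [|i s IH].
  rewrite big_nil; under eq_fun do rewrite big_nil; exact: cvg_cst.
rewrite big_cons; under eq_fun do rewrite big_cons.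
apply: cvgeD (fl i) IH; apply: ltpinfty_adde_def; rewrite inE //.
by apply: lte_sum_pinfty => j _.
Qed.

End ErealLimits.

Section ErealSplit.
Variable R : realType.
Implicit Types x y : \bar R.

(** Used to turn a strict bound on a sum into separate strict bounds on its terms, which are stable
    under small changes of each term. *)
Lemma adde_lt_split x y (c : R) : (x < +oo)%E -> (y < +oo)%E -> (x + y < c%:E)%E ->
  exists a b : R, [/\ (x < a%:E)%E, (y < b%:E)%E & a + b = c].
Proof.
case: x => [x| |] //; case: y => [y| |] // _ _.
- rewrite -EFinD lte_fin => xyc; exists (x + (c - x - y) / 2), (y + (c - x - y) / 2).
  by rewrite !lte_fin; split; lra.
- by move=> _; exists (x + 1), (c - x - 1); rewrite lte_fin ltNye; split => //; lra.
- by move=> _; exists (c - y - 1), (y + 1); rewrite lte_fin ltNye; split => //; lra.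
- by move=> _; exists 0, c; rewrite !ltNye; split => //; lra.
Qed.

Lemma adde_gt_split x y (c : R) : (x < +oo)%E -> (y < +oo)%E -> (c%:E < x + y)%E ->
  exists a b : R, [/\ (a%:E < x)%E, (b%:E < y)%E & a + b = c].
Proof.
case: x => [x| |] //; case: y => [y| |] // _ _.
rewrite -EFinD lte_fin => xyc; exists (x + (c - x - y) / 2), (y + (c - x - y) / 2).
by rewrite !lte_fin; split; lra.
Qed.

Lemma lte_exists_between (c : R) x : (c%:E < x)%E -> exists2 d : R, c < d & (d%:E < x)%E.
Proof.
case: x => [x| |] //; last by move=> _; exists (c + 1); [lra|rewrite ltry].
by rewrite lte_fin => cx; exists ((c + x) / 2); rewrite ?lte_fin; lra.
Qed.

End ErealSplit.

(** Limits along such an ultrafilter replace the successive extraction of subsequences: all bounded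
    sequences converge along it at once. *)
Lemma ultra_oo : exists2 U : set_system nat, UltraFilter U & \oo `<=` U.
Proof. by have [U [UU ooU]] := ultraFilterLemma (F := \oo) _; exists U. Qed.

Lemma ultra_bounded_cvg (R : realType) (U : set_system nat) (u : nat -> R) (a b : R) :
  UltraFilter U -> (\forall k \near U, a <= u k <= b) -> exists l : R, u @ U --> l.
Proof.
move=> UU uab; have := @segment_compact R a b; rewrite compact_ultra => h.
have UI : UltraFilter (u @ U).
  split=> [|G GG uUG]; first exact: fmap_proper_filter.
  rewrite predeqE => A; split=> [GA|]; last exact: uUG.
  have [//|UnA] := in_ultra_setVsetC (u @^-1` A) UU.
  by have /filter_ex[z []] : G (A `&` ~` A) by apply: filterI => //; exact: uUG.
have [|l [_ ul]] := h _ UI; last by exists l.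
by apply: filterS uab => k /=; rewrite in_itv.
Qed.

(** * The comparison principle *)

Section Abel.
Variable R : realFieldType.

(** Summation by parts leaves a boundary term and terms [(s i - s i.+1) * e i.+1], all nonnegative.
    The induction keeps the boundary term as a lower bound for the partial sum. *)
Lemma abel_sum_ge0 (m : nat) (s e : nat -> R) :
  (forall i, (i <= m)%N -> 0 <= e i) -> e 0%N = 0 ->
  (forall i, (i < m)%N -> 0 <= s i) ->
  (forall i, (i.+1 < m)%N -> s i.+1 <= s i) ->
  0 <= \sum_(0 <= i < m) s i * (e i.+1 - e i).
Proof.
move=> e_ge0 e0 s_ge0 s_dec.
suff key p : (p < m)%N -> s p * e p.+1 <= \sum_(0 <= i < p.+1) s i * (e i.+1 - e i).
  case: m e_ge0 s_ge0 s_dec key => [|m] e_ge0 s_ge0 s_dec key; first by rewrite big_geq.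
  by apply: le_trans (key m _) => //; rewrite mulr_ge0 ?s_ge0 ?e_ge0.
elim: p => [|p IH] pm; first by rewrite big_nat1 e0 subr0.
rewrite big_nat_recr //=.
have {}IH := IH (ltnW pm).
have sp := s_dec p pm; have ep : 0 <= e p.+1 by apply: e_ge0; exact: ltnW.
nra.
Qed.

End Abel.

(** Monotone concavity on a half-line, expressed by a choice of supergradients. Only [a] may be 0,
    because the kernel may have no supporting line there. *)
Definition supporting (R : realType) (k : R -> \bar R) (s : R -> R) : Prop :=
  [/\ forall b, 0 < b -> 0 <= s b,
      forall a b, 0 < a -> a <= b -> s b <= s a
    & forall a b, 0 <= a -> 0 < b -> (k a <= k b + (s b * (a - b))%:E)%E].

Definition strictly_supporting (R : realType) (k : R -> \bar R) (s : R -> R) : Prop :=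
  forall a b, 0 <= a -> 0 < b -> a != b -> (k a < k b + (s b * (a - b))%:E)%E.

Definition nondecr_upto (R : realType) (n : nat) (y : nat -> R) : Prop :=
  forall i j, (i <= j)%N -> (j < n)%N -> y i <= y j.

Definition ncell (R : realType) (n : nat) (y : nat -> R) (j : nat) : set R :=
  [set t | ((0 < j)%N -> y j.-1 <= t) /\ ((j < n)%N -> t <= y j)].

Section Comparison.
Variables (R : realType) (n : nat) (r : nat -> R).
Hypothesis r_gt0 : forall i, 0 < r i.
Implicit Types (x y : nat -> R) (t : R).

(** This is D_l of the overview. Its increments have the sign of [x l - y l], which is what a
    maximizing index exploits. *)
Definition wshift x y (l : nat) : R := \sum_(0 <= i < l) r i * (x i - y i).

Lemma wshiftS x y l : wshift x y l.+1 = wshift x y l + r l * (x l - y l).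
Proof. by rewrite /wshift big_nat_recr. Qed.

Definition wshift_argmax x y j :=
  (j <= n)%N /\ forall l, (l <= n)%N -> wshift x y l <= wshift x y j.

Lemma ex_wshift_argmax x y : exists j, wshift_argmax x y j.
Proof.
pose f (j : 'I_n.+1) := wshift x y j.
case: (arg_maxP f (isT : xpredT (ord0 : 'I_n.+1))) => j _ jmax.
exists j; split=> [|l ln]; first by rewrite -ltnS.
exact: (jmax (Ordinal (ln : (l < n.+1)%N)) isT).
Qed.

Definition psum (k : R -> \bar R) x t : \bar R := (\sum_(i < n) (r i)%:E * k (t - x i)%R)%E.

Section AtArgmax.
Variables (x y : nat -> R) (j : nat) (t : R).
Hypothesis x_inc : nondecr_upto n x.
Hypothesis y_inc : nondecr_upto n y.
Hypothesis jmax : wshift_argmax x y j.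
Hypothesis xjt : ncell n x j t.

(** Comparing D at j with its neighbours gives [y j.-1 <= x j.-1] and [x j <= y j], so the cell of
    [y] contains that of [x]. *)
Lemma argmax_cell : ncell n y j t.
Proof.
case: jmax xjt => jn Dj [xl xr]; split.
  move=> j0; apply: le_trans (xl j0).
  have := Dj j.-1 (leq_trans (leq_pred j) jn); rewrite -{2}(prednK j0) wshiftS lerDl.
  by rewrite pmulr_rge0 // subr_ge0.
move=> ltjn; apply: le_trans (xr ltjn) _.
have := Dj _ ltjn; rewrite wshiftS gerDl.
by rewrite pmulr_rle0 // subr_le0.
Qed.

Let cell_left l : (l < j)%N -> x l <= t /\ y l <= t.
Proof.
move=> lj; have j0 : (0 < j)%N by case: (j) lj.
have ltjn : (j.-1 < n)%N by rewrite prednK //; case: jmax.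
have llj : (l <= j.-1)%N by rewrite -ltnS prednK.
by split; [apply: le_trans (xjt.1 j0); exact: x_inc
          |apply: le_trans (argmax_cell.1 j0); exact: y_inc].
Qed.

Let cell_right l : (j <= l)%N -> (l < n)%N -> t <= x l /\ t <= y l.
Proof.
move=> jl ln; have jn := leq_ltn_trans jl ln.
by split; [apply: le_trans (xjt.2 jn) _; exact: x_inc
          |apply: le_trans (argmax_cell.2 jn) _; exact: y_inc].
Qed.

(** The nodes of [y] from i to [j.-1] all equal t, while those of [x] do not exceed t, so D does not
    increase from [i.+1] to j. Maximality at j then forbids a decrease at step i, which forces
    [y i <= x i]. *)
Lemma argmax_eq_left i : (i < j)%N -> y i = t -> x i = y i.
Proof.
move=> ij yit; have [jn Dj] := jmax.
have dec p : (i + p < j)%N -> wshift x y (i + p).+1 <= wshift x y i.+1.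
  elim: p => [|p IH] ipj; first by rewrite addn0.
  rewrite addnS in ipj *; apply: le_trans (IH (ltnW ipj)); rewrite wshiftS gerDl.
  rewrite pmulr_rle0 // subr_le0; have [xl _] := cell_left ipj.
  apply: le_trans xl _; rewrite -yit; apply: y_inc; first lia.
  exact: leq_trans ipj jn.
have := dec (j - i.+1)%N; rewrite -addSn subnKC // leqnn => /(_ isT); rewrite wshiftS => h1.
have h2 := Dj i (ltnW (leq_trans ij jn)).
have : 0 <= r i * (x i - y i) by lra.
rewrite pmulr_rge0 // subr_ge0 => yx.
by apply/le_anti; rewrite yx yit (cell_left ij).1.
Qed.

Lemma argmax_eq_right i : (j <= i)%N -> (i < n)%N -> y i = t -> x i = y i.
Proof.
move=> ji ltin yit; have [jn Dj] := jmax.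
have inc p : (j + p <= i)%N -> wshift x y j <= wshift x y (j + p).
  elim: p => [|p IH] jpi; first by rewrite addn0.
  rewrite addnS in jpi *; apply: le_trans (IH (ltnW jpi)) _; rewrite wshiftS lerDl.
  rewrite pmulr_rge0 // subr_ge0.
  have jpn : (j + p < n)%N by lia.
  have [tx _] := cell_right (leq_addr p j) jpn.
  by apply: le_trans tx; rewrite -yit; apply: y_inc; lia.
have := inc (i - j)%N; rewrite subnKC // => /(_ (leqnn _)) h1.
have := Dj _ ltin; rewrite wshiftS => h2.
have : r i * (x i - y i) <= 0 by lra.
rewrite pmulr_rle0 // subr_le0 => xy.
by apply/le_anti; rewrite xy yit (cell_right ji ltin).1.
Qed.

Variables (k : R -> \bar R) (sp sn : R -> R).
Hypothesis kp : supporting k sp.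
Hypothesis kn : supporting (fun u => k (- u)) sn.

Let capL := \sum_(0 <= i < j) (if t == y i then 0 else sp (t - y i)).
Let capR := \sum_(j <= i < n) (if t == y i then 0 else sn (y i - t)).

(* Where [t = y i] the kernel may have no supporting line at [t - y i = 0]; there
   [x i = y i], so any slope will do and one dominating all the others is taken. *)
Let slope i :=
  if (i < j)%N then (if t == y i then capL else sp (t - y i))
  else (if t == y i then - capR else - sn (y i - t)).

Let sp_ge0 i : (i < j)%N -> 0 <= (if t == y i then 0 else sp (t - y i)).
Proof.
move=> ij; case: eqVneq => // tyi; case: kp => + _ _; apply.
by rewrite subr_gt0 lt_neqAle eq_sym tyi; case: (cell_left ij).
Qed.

Let sn_ge0 i : (j <= i)%N -> (i < n)%N -> 0 <= (if t == y i then 0 else sn (y i - t)).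
Proof.
move=> ji ltin; case: eqVneq => // tyi; case: kn => + _ _; apply.
by rewrite subr_gt0 lt_neqAle tyi; case: (cell_right ji ltin).
Qed.

Let capL_ge i : (i < j)%N -> t != y i -> sp (t - y i) <= capL.
Proof.
move=> ij tyi; rewrite /capL (@big_cat_nat _ _ _ i) //=; last exact: ltnW.
rewrite (big_ltn ij) (negbTE tyi) addrCA lerDl addr_ge0 //.
  by rewrite big_nat_cond; apply: sumr_ge0 => l; rewrite andbT => /andP[_ li]; apply: sp_ge0; lia.
by rewrite big_nat_cond; apply: sumr_ge0 => l; rewrite andbT => /andP[_ li]; apply: sp_ge0; lia.
Qed.

Let capR_ge i : (j <= i)%N -> (i < n)%N -> t != y i -> sn (y i - t) <= capR.
Proof.
move=> ji ltin tyi; rewrite /capR (@big_cat_nat _ _ _ i) //=; last exact: ltnW.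
rewrite (big_ltn ltin) (negbTE tyi) addrCA lerDl addr_ge0 //.
  by rewrite big_nat_cond; apply: sumr_ge0 => l; rewrite andbT => /andP[li1 li]; apply: sn_ge0; lia.
by rewrite big_nat_cond; apply: sumr_ge0 => l; rewrite andbT => /andP[li1 li]; apply: sn_ge0; lia.
Qed.

Let capL_ge0 : 0 <= capL.
Proof.
by rewrite /capL big_nat_cond; apply: sumr_ge0 => l; rewrite andbT => /andP[_ li]; apply: sp_ge0.
Qed.

Let capR_ge0 : 0 <= capR.
Proof.
by rewrite /capR big_nat_cond; apply: sumr_ge0 => l; rewrite andbT => /andP[li1 li]; apply: sn_ge0.
Qed.

Let slope_left_ge0 i : (i < j)%N -> 0 <= slope i.
Proof.
by move=> ij; rewrite /slope ij; have := sp_ge0 ij; case: eqVneq.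
Qed.

Let slope_right_le0 i : (j <= i)%N -> (i < n)%N -> 0 <= - slope i.
Proof.
move=> ji ltin; rewrite /slope ltnNge ji /=; have := sn_ge0 ji ltin.
by case: eqVneq; rewrite opprK.
Qed.

Let slope_left_le a b : (a <= b)%N -> (b < j)%N -> slope a <= slope b.
Proof.
move=> ab bj; have aj := leq_ltn_trans ab bj; rewrite /slope aj bj.
have yab : y a <= y b by apply: y_inc => //; case: jmax => + _; exact: leq_trans.
have [_ yb] := cell_left bj.
have [tyb|tyb] := eqVneq t (y b).
  by case: eqVneq => // tya; exact: capL_ge.
have [tya|tya] := eqVneq t (y a).
  by case/eqP: tyb; apply/le_anti; rewrite yb {1}tya yab.
case: kp => _ + _; apply; last by rewrite lerD2l lerN2.
by rewrite subr_gt0 lt_neqAle eq_sym tyb.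
Qed.

Let slope_right_le a b : (j <= a)%N -> (a <= b)%N -> (b < n)%N -> - slope b <= - slope a.
Proof.
move=> ja ab bn; have jb := leq_trans ja ab.
rewrite /slope !ltnNge ja jb /=.
have yab : y a <= y b by exact: y_inc.
have [_ ya] := cell_right ja (leq_ltn_trans ab bn).
have [tya|tya] := eqVneq t (y a); rewrite ?opprK.
  by case: eqVneq => // tyb; rewrite opprK //; exact: capR_ge.
have [tyb|tyb] := eqVneq t (y b).
  by case/eqP: tya; apply/le_anti; rewrite ya tyb yab.
rewrite opprK; case: kn => _ + _; apply; last by rewrite lerD2r.
by rewrite subr_gt0 lt_neqAle tya.
Qed.

(** On each side of j the deficits of D below its maximum vanish at j and are nonnegative, and the
    slopes shrink in absolute value away from j. Counting indices from j, [abel_sum_ge0] applies to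
    both halves. *)
Let slope_sum_ge0 : 0 <= \sum_(0 <= i < n) slope i * (wshift x y i.+1 - wshift x y i).
Proof.
have [jn Dj] := jmax; rewrite (@big_cat_nat _ _ _ j) //= addr_ge0 //.
  rewrite big_nat_rev /= add0n.
  pose e i := wshift x y j - wshift x y (j - i).
  rewrite (eq_big_nat _ _ (F2 := fun i => slope (j - i.+1) * (e i.+1 - e i))).
    apply: abel_sum_ge0.
    - by move=> i ij; rewrite subr_ge0; apply: Dj; lia.
    - by rewrite /e subn0 subrr.
    - by move=> i ij; apply: slope_left_ge0; lia.
    - by move=> i ij; apply: slope_left_le; lia.
  move=> i /andP[_ ij]; rewrite subnSK //; congr (_ * _); rewrite /e; ring.
rewrite -{1}(add0n j) big_addn.
pose e i := wshift x y j - wshift x y (i + j).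
rewrite (eq_big_nat _ _ (F2 := fun i => - slope (i + j) * (e i.+1 - e i))).
  apply: abel_sum_ge0.
  - by move=> i ij; rewrite subr_ge0; apply: Dj; lia.
  - by rewrite /e add0n subrr.
  - by move=> i ij; apply: slope_right_le0; lia.
  - by move=> i ij; apply: slope_right_le; lia.
by move=> i _; rewrite /e addSn; ring.
Qed.

Let shift_sum_ge0 : 0 <= \sum_(i < n) r i * (slope i * (x i - y i)).
Proof.
rewrite -(big_mkord xpredT (fun i => r i * (slope i * (x i - y i)))).
rewrite (eq_bigr (fun i => slope i * (wshift x y i.+1 - wshift x y i))) // => i _.
by rewrite wshiftS; ring.
Qed.

Let kernel_slope (i : 'I_n) : (k (t - x i) <= k (t - y i) + (- (slope i * (x i - y i)))%:E)%E.
Proof.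
rewrite /slope; case: ltnP => [ij|ji].
  have [xit yit] := cell_left ij.
  have [tyi|tyi] := eqVneq t (y i).
    by rewrite (argmax_eq_left ij (esym tyi)) subrr mulr0 oppr0 adde0.
  rewrite -mulrN; have -> : - (x i - y i) = t - x i - (t - y i) by ring.
  by case: kp => _ _; apply; rewrite ?subr_ge0 // subr_gt0 lt_neqAle eq_sym tyi.
have [xit yit] := cell_right ji (ltn_ord i).
have [tyi|tyi] := eqVneq t (y i).
  by rewrite (argmax_eq_right ji (ltn_ord i) (esym tyi)) subrr mulr0 oppr0 adde0.
rewrite mulNr opprK; have -> : x i - y i = x i - t - (y i - t) by ring.
rewrite -(opprB (x i)) -(opprB (y i)).
by case: kn => _ _; apply; rewrite ?subr_ge0 // subr_gt0 lt_neqAle tyi.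
Qed.

Let kernel_slope_strict (i : 'I_n) :
  strictly_supporting k sp -> strictly_supporting (fun u => k (- u)) sn -> x i != y i ->
  (k (t - x i) < k (t - y i) + (- (slope i * (x i - y i)))%:E)%E.
Proof.
move=> kps kns xyi; rewrite /slope; case: ltnP => [ij|ji].
  have [xit yit] := cell_left ij.
  have [tyi|tyi] := eqVneq t (y i).
    by rewrite (argmax_eq_left ij (esym tyi)) eqxx in xyi.
  rewrite -mulrN; have -> : - (x i - y i) = t - x i - (t - y i) by ring.
  apply: kps; rewrite ?subr_ge0 // ?subr_gt0 ?lt_neqAle 1?eq_sym ?tyi //.
  by apply: contra xyi => /eqP h; apply/eqP; lra.
have [xit yit] := cell_right ji (ltn_ord i).
have [tyi|tyi] := eqVneq t (y i).
  by rewrite (argmax_eq_right ji (ltn_ord i) (esym tyi)) eqxx in xyi.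
rewrite mulNr opprK; have -> : x i - y i = x i - t - (y i - t) by ring.
rewrite -(opprB (x i)) -(opprB (y i)).
apply: kns; rewrite ?subr_ge0 // ?subr_gt0 ?lt_neqAle ?tyi //.
by apply: contra xyi => /eqP h; apply/eqP; lra.
Qed.

(** Adding the supporting-line bounds of the translates with weights [r i] leaves one linear
    correction, whose sign is given by [shift_sum_ge0]. *)
Lemma argmax_psum_le : (psum k x t <= psum k y t)%E.
Proof.
apply: (@le_trans _ _ (psum k y t + (- \sum_(i < n) r i * (slope i * (x i - y i)))%:E)%E); last first.
  by rewrite geeDl // lee_fin oppr_le0 shift_sum_ge0.
rewrite /psum -sumrN -sumEFin -big_split /=; apply: lee_sum => i _.
rewrite -mulrN EFinM -muleDr // ?fin_num_adde_defl //.
by apply: lee_wpmul2l; [rewrite lee_fin ltW|exact: kernel_slope].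
Qed.

Lemma argmax_psum_lt (i0 : 'I_n) : strictly_supporting k sp ->
  strictly_supporting (fun u => k (- u)) sn ->
  x i0 != y i0 -> psum k x t \is a fin_num -> (psum k x t < psum k y t)%E.
Proof.
move=> kps kns xyi0 /sum_fin_numP xfin.
apply: (@lt_le_trans _ _ (psum k y t + (- \sum_(i < n) r i * (slope i * (x i - y i)))%:E)%E); last first.
  by rewrite geeDl // lee_fin oppr_le0 shift_sum_ge0.
rewrite /psum -sumrN -sumEFin -big_split /=.
have termE i : ((r i)%:E * k (t - y i) + (- (r i * (slope i * (x i - y i))))%:E =
    (r i)%:E * (k (t - y i) + (- (slope i * (x i - y i)))%:E))%E.
  by rewrite -mulrN EFinM -muleDr // fin_num_adde_defl.
(* Finiteness of the other terms of [psum k x t] keeps the strict gain at [i0] from being absorbed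
   by -oo. *)
rewrite (bigD1 i0) //= [ltRHS](bigD1 i0) //=; apply: lte_leD.
- by apply/sum_fin_numP => i _ _; exact: xfin.
- by rewrite termE lte_pmul2l ?lte_fin //; exact: kernel_slope_strict.
- apply: lee_sum => i _; rewrite termE; apply: lee_wpmul2l; first by rewrite lee_fin ltW.
  exact: kernel_slope.
Qed.

End AtArgmax.

End Comparison.

(** * A priori bounds *)

Record kernel_slopes (R : realType) (k : R -> \bar R) (sp sn : R -> R) : Prop := KernelSlopes {
  ks_cont : continuous k;
  ks_fin : forall t, t != 0 -> k t \is a fin_num;
  ks_lty : forall t, (k t < +oo)%E;
  ks_pos : supporting k sp;
  ks_neg : supporting (fun t => k (- t)) sn }.

(** [fb_fin] lists the points of finiteness in increasing order, n + 1 of them, so that each cell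
    can receive one. *)
Record field_bounds (R : realType) (n : nat) (rho : R) (k J : R -> \bar R) : Prop := FieldBounds {
  fb_ub : exists C : R, forall t, (J t <= C%:E)%E;
  fb_adm : forall A : R, exists T : R, forall t, T <= `|t| -> (J t + rho%:E * k t <= A%:E)%E;
  fb_fin : exists2 a : nat -> R, (forall i, (i < n)%N -> a i < a i.+1) &
             forall i, (i <= n)%N -> J (a i) \is a fin_num }.

Section Supporting.
Variables (R : realType) (k : R -> \bar R) (s : R -> R).
Hypothesis ks : supporting k s.

Lemma supporting_homo a b : 0 <= a -> a <= b -> (k a <= k b)%E.
Proof.
move=> a0 ab; have [s0 _ sup] := ks.
have [b0|b0] := ltP 0 b; last by have -> : a = b by lra.
apply: le_trans (sup a b a0 b0) _; rewrite geeDl // lee_fin mulr_ge0_le0 ?s0 //.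
by rewrite subr_le0.
Qed.

(** The supporting line at [t] costs at most [s t * B] per unit of weight, and [s t <= s 1] makes
    this error independent of [t]. Decay of the sum thus reduces to admissibility. *)
Lemma supporting_sum_le (n : nat) (r y : nat -> R) (B t : R) :
  (forall i, 0 < r i) -> (forall t, (k t < +oo)%E) ->
  (forall i, (i < n)%N -> `|y i| <= B) -> 1 <= t -> B <= t ->
  (psum n r k y t <= (\sum_(i < n) r i)%:E * k t + ((\sum_(i < n) r i) * (s 1 * B))%:E)%E.
Proof.
move=> r0 kty yB t1 Bt; have [s0 sdec sup] := ks.
have t0 : 0 < t by lra.
have bound (i : 'I_n) : (k (t - y i) <= k t + (s 1 * B)%:E)%E.
  have yiB := yB i (ltn_ord i); have := ler_norm (y i); have := ler_norm (- y i).
  rewrite normrN => h1 h2.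
  have ge0 : 0 <= t - y i by lra.
  apply: le_trans (sup _ _ ge0 t0) _; apply: leeD2l; rewrite lee_fin.
  have s1 := sdec _ _ ltr01 t1; have st := s0 _ t0.
  have -> : t - y i - t = - y i by ring.
  apply: (@le_trans _ _ (s t * B)); first by rewrite ler_wpM2l //; lra.
  by rewrite ler_wpM2r //; lra.
rewrite /psum; apply: (@le_trans _ _ (\sum_(i < n) (r i)%:E * (k t + (s 1 * B)%:E))%E).
  by apply: lee_sum => i _; apply: lee_wpmul2l; rewrite // lee_fin ltW.
rewrite -ge0_sume_distrl; last by move=> i _; rewrite lee_fin ltW.
by rewrite sumEFin muleDr // ?fin_num_adde_defl // -EFinM.
Qed.

(** All translates are compared with the one supporting line at [t]; the linear terms add up to
    [- s t] times the weighted sum of the nodes, which is nonpositive. *)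
Lemma supporting_jensen (n : nat) (r y : nat -> R) (t : R) :
  (forall i, 0 < r i) -> 0 < t ->
  (forall i, (i < n)%N -> y i <= t) -> 0 <= \sum_(i < n) r i * y i ->
  (psum n r k y t <= (\sum_(i < n) r i)%:E * k t)%E.
Proof.
move=> r0 t0 yt mean; have [s0 sdec sup] := ks.
apply: (@le_trans _ _ (\sum_(i < n) ((r i)%:E * k t + (- (s t * (r i * y i)))%:E))%E).
  apply: lee_sum => i _.
  have -> : (- (s t * (r i * y i)))%:E = ((r i)%:E * (s t * (t - y i - t))%:E)%E.
    by rewrite -EFinM; congr EFin; ring.
  rewrite -muleDr // ?fin_num_adde_defl //.
  apply: lee_wpmul2l; first by rewrite lee_fin ltW.
  by apply: sup => //; rewrite subr_ge0 yt.
rewrite big_split /= sumEFin sumrN -mulr_sumr -ge0_sume_distrl; last by move=> i _; rewrite lee_fin ltW.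
by rewrite sumEFin geeDl // lee_fin oppr_le0 mulr_ge0 // s0.
Qed.

End Supporting.

Section Field.
Variables (R : realType) (n : nat) (r : nat -> R) (k : R -> \bar R) (sp sn : R -> R).
Variable J : R -> \bar R.
Hypothesis r_gt0 : forall i, 0 < r i.
Hypothesis n_gt0 : (0 < n)%N.
Hypothesis kS : kernel_slopes k sp sn.
Local Notation rho := (\sum_(i < n) r i).
Hypothesis fB : field_bounds n rho k J.
Implicit Types (x y : nat -> R) (t : R) (j : nat).

(* Nodes and weights are sequences of which only the entries below [n] matter; a tuple [y]
   is read as [nth 0 y], see [int_max_imax]. *)
Definition tsum y t : \bar R := (J t + psum n r k y t)%E.
Definition imax y j : \bar R := ereal_sup [set tsum y t | t in ncell n y j].

Lemma rho_gt0 : 0 < rho.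
Proof.
case: n n_gt0 => // m _; rewrite big_ord_recl ltr_pwDl //.
by apply: sumr_ge0 => i _; exact: ltW.
Qed.

Lemma psum_lty y t : (psum n r k y t < +oo)%E.
Proof.
apply: lte_sum_pinfty => i _; apply: lte_mul_pinfty => //; last exact: (ks_lty kS).
by rewrite lee_fin ltW.
Qed.

Lemma J_lty t : (J t < +oo)%E.
Proof. by have [C JC] := fb_ub fB; apply: le_lt_trans (JC t) _; rewrite ltry. Qed.

Lemma tsum_lty y t : (tsum y t < +oo)%E.
Proof. by apply: lte_add_pinfty; [exact: J_lty|exact: psum_lty]. Qed.

Lemma imax_ge y j t : ncell n y j t -> (tsum y t <= imax y j)%E.
Proof. by move=> yjt; apply: ereal_sup_ubound; exists t. Qed.

Lemma imax_gtP y j (c : \bar R) : (c < imax y j)%E -> exists2 t, ncell n y j t & (c < tsum y t)%E.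
Proof. by case/ereal_sup_gt => _ [t yjt <-] ct; exists t. Qed.

Lemma imax_argmax_le x y j : nondecr_upto n x -> nondecr_upto n y ->
  wshift_argmax n r x y j -> (imax x j <= imax y j)%E.
Proof.
move=> xs ys jm; apply: ge_ereal_sup => _ [t xjt <-].
apply: le_trans (imax_ge (argmax_cell r_gt0 jm xjt)).
by apply: leeD2l; apply: (argmax_psum_le r_gt0 xs ys jm xjt (ks_pos kS) (ks_neg kS)).
Qed.

Lemma ex_imax_le x y : nondecr_upto n x -> nondecr_upto n y ->
  exists2 j, (j <= n)%N & (imax x j <= imax y j)%E.
Proof.
move=> xs ys; have [j jm] := ex_wshift_argmax n r x y.
by exists j; [case: jm|exact: imax_argmax_le].
Qed.

Lemma psum_reflect y t : psum n r k y t = psum n r (fun u => k (- u)) (fun i => - y i) (- t).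
Proof. by rewrite /psum; apply: eq_bigr => i _; congr (_ * k _)%E; ring. Qed.

(** The threshold is uniform over nodes bounded by [B], so near-maximal points cannot escape to
    infinity while the nodes stay bounded. *)
Lemma tsum_decay (B A : R) : exists T : R, forall y, (forall i, (i < n)%N -> `|y i| <= B) ->
  forall t, T <= `|t| -> (tsum y t <= A%:E)%E.
Proof.
pose c := rho * (sp 1 * B); pose d := rho * (sn 1 * B).
have [T1 adm1] := fb_adm fB (A - c); have [T2 adm2] := fb_adm fB (A - d).
exists (Num.max 1 (Num.max B (Num.max T1 T2))) => y yB t.
rewrite !ge_max => /and4P[t1 tB tT1 tT2]; rewrite /tsum.
have [t0|t0] := leP 0 t.
  rewrite ger0_norm // in t1 tB tT1 tT2.
  apply: (@le_trans _ _ (J t + rho%:E * k t + c%:E)%E).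
    rewrite -addeA; apply: leeD2l; apply: (supporting_sum_le (ks_pos kS)) => //.
    exact: (ks_lty kS).
  have -> : A%:E = ((A - c)%:E + c%:E)%E by rewrite -EFinD subrK.
  by apply: leeD2r; apply: adm1; rewrite ger0_norm.
rewrite ltr0_norm // in t1 tB tT1 tT2.
apply: (@le_trans _ _ (J t + rho%:E * k t + d%:E)%E).
  rewrite -addeA; apply: leeD2l; rewrite psum_reflect -{2}(opprK t).
  apply: (supporting_sum_le (ks_neg kS)) => //; first by move=> u; exact: (ks_lty kS).
  by move=> i ltin; rewrite normrN; exact: yB.
have -> : A%:E = ((A - d)%:E + d%:E)%E by rewrite -EFinD subrK.
by apply: leeD2r; apply: adm2; rewrite ltr0_norm.
Qed.

Lemma tsum_bounded (B : R) : exists A : R, forall y, (forall i, (i < n)%N -> `|y i| <= B) ->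
  forall t, (tsum y t <= A%:E)%E.
Proof.
have [T dec] := tsum_decay B 0; have [C JC] := fb_ub fB.
(* [u] dominates [|t - y i|] whenever [|t| < T]; being at least 1, it is a point where the kernel is
   finite on both sides. *)
pose u := Num.max 1 (T + B).
have u0 : 0 < u by rewrite lt_max ltr01.
have [p kup] : exists p, k u = p%:E.
  by exists (fine (k u)); rewrite fineK // (ks_fin kS) // gt_eqF.
have [q kuq] : exists q, k (- u) = q%:E.
  by exists (fine (k (- u))); rewrite fineK // (ks_fin kS) // oppr_eq0 gt_eqF.
pose m := Num.max p q.
exists (Num.max 0 (C + \sum_(i < n) r i * m)) => y yB t.
have [tT|tT] := leP T `|t|.
  by apply: le_trans (dec y yB t tT) _; rewrite lee_fin le_max lexx.
apply: (@le_trans _ _ (C + \sum_(i < n) r i * m)%:E); last by rewrite lee_fin le_max lexx orbT.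
rewrite EFinD -sumEFin; apply: leeD; first exact: JC.
apply: lee_sum => i _; rewrite EFinM; apply: lee_wpmul2l; first by rewrite lee_fin ltW.
have tyu : `|t - y i| <= u.
  by rewrite le_max; apply/orP; right; apply: le_trans (ler_normB _ _) _; rewrite lerD ?yB // ltW.
have [h|h] := leP 0 (t - y i).
  rewrite ger0_norm // in tyu; apply: le_trans (supporting_homo (ks_pos kS) h tyu) _.
  by rewrite kup lee_fin le_max lexx.
rewrite ltr0_norm // in tyu; rewrite -(opprK (t - y i)).
have h' : 0 <= - (t - y i) by lra.
apply: le_trans (supporting_homo (ks_neg kS) h' tyu) _.
by rewrite kuq lee_fin le_max lexx orbT.
Qed.

(** A very negative node could not be compensated by the others, which are at most [T]: this gives
    [r i * y i >= - (rho * T)]. The sum over l dominates each [rho / r i] and so makes the bound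
    independent of i. *)
Lemma weighted_lb y (T : R) : 0 <= T -> (forall i, (i < n)%N -> y i <= T) ->
  0 <= \sum_(i < n) r i * y i -> forall i, (i < n)%N -> - (T * \sum_(l < n) rho / r l) <= y i.
Proof.
move=> T0 yT mean i ltin; pose i0 := Ordinal ltin.
have rh := rho_gt0.
have h1 : r i * y i >= - (rho * T).
  rewrite (bigD1 i0) //= in mean.
  have : \sum_(l < n | l != i0) r l * y l <= \sum_(l < n | l != i0) r l * T.
    by apply: ler_sum => l _; rewrite ler_wpM2l ?yT // ltW.
  rewrite -mulr_suml.
  have : \sum_(l < n | l != i0) r l * T <= rho * T.
    by rewrite -mulr_suml ler_wpM2r // [leRHS](bigD1 i0) //= lerDr ltW.
  by rewrite -mulr_suml; lra.
have h2 : rho / r i <= \sum_(l < n) rho / r l.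
  rewrite [leRHS](bigD1 i0) //= lerDl; apply: sumr_ge0 => l _.
  by rewrite divr_ge0 // ltW.
have h3 : - (rho * T / r i) <= y i.
  by rewrite -mulNr ler_pdivrMr // [leRHS]mulrC.
apply: le_trans h3; rewrite lerN2 mulrAC mulrC ler_wpM2l //.
Qed.

(** If the weighted sum of the nodes is nonnegative and the last node exceeds [T], Jensen's
    inequality and admissibility push the last local maximum below [A]. So the nodes are at most
    [T], and [weighted_lb] bounds them below. The other sign is the mirror image, with the first
    cell. *)
Lemma superlevel_bounded (A : R) : exists B : R, forall y, nondecr_upto n y ->
  (forall j, (j <= n)%N -> (A%:E <= imax y j)%E) -> forall i, (i < n)%N -> `|y i| <= B.
Proof.
have [T0 adm] := fb_adm fB (A - 1); pose T := Num.max 1 T0.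
have T0T : T0 <= T by rewrite le_max lexx orbT.
have Tgt0 : 0 < T by rewrite lt_max ltr01.
have W0 : 0 <= T * \sum_(l < n) rho / r l.
  apply: mulr_ge0; first exact: ltW.
  by apply: sumr_ge0 => l _; rewrite divr_ge0 // ltW // rho_gt0.
exists (T + T * \sum_(l < n) rho / r l) => y ys yA.
have n1 : (n.-1 < n)%N by rewrite prednK.
have [mean|mean] := leP 0 (\sum_(i < n) r i * y i).
  have yT i : (i < n)%N -> y i <= T.
    move=> ltin; rewrite leNgt; apply/negP => Ty.
    have Tyn : T < y n.-1 by apply: lt_le_trans Ty _; apply: ys => //; lia.
    have := yA n (leqnn n); apply/negP; rewrite -ltNge.
    apply: (@le_lt_trans _ _ (A - 1)%:E); last by rewrite lte_fin; lra.
    apply: ge_ereal_sup => _ [t [+ _] <-] => /(_ n_gt0) ynt.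
    have t0 : 0 < t by lra.
    apply: le_trans (adm t _); last by rewrite ger0_norm; lra.
    apply: leeD2l; apply: (supporting_jensen (ks_pos kS)) => // l ln.
    by apply: le_trans ynt; apply: ys => //; lia.
  move=> i ltin; rewrite ler_norml; have := weighted_lb (ltW Tgt0) yT mean ltin; have := yT i ltin.
  lra.
pose z i := - y i.
have zmean : 0 <= \sum_(i < n) r i * z i.
  rewrite (eq_bigr (fun i : 'I_n => - (r i * y i))) ?sumrN; last by move=> i _; rewrite /z mulrN.
  by rewrite oppr_ge0 ltW.
have zT i : (i < n)%N -> z i <= T.
  move=> ltin; rewrite leNgt; apply/negP => Tz.
  have Tz0 : T < - y 0%N by apply: lt_le_trans Tz _; rewrite lerN2; exact: ys.
  have := yA 0%N (leq0n n); apply/negP; rewrite -ltNge.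
  apply: (@le_lt_trans _ _ (A - 1)%:E); last by rewrite lte_fin; lra.
  apply: ge_ereal_sup => _ [t [_ +] <-] => /(_ n_gt0) ty0.
  have t0 : t < 0 by lra.
  apply: le_trans (adm t _); last by rewrite ltr0_norm; lra.
  apply: leeD2l; rewrite psum_reflect -{2}(opprK t).
  apply: (supporting_jensen (ks_neg kS)) => //; first by lra.
  by move=> l ln; rewrite lerN2; apply: le_trans ty0 _; exact: ys.
move=> i ltin; rewrite ler_norml; have := weighted_lb (ltW Tgt0) zT zmean ltin; have := zT i ltin.
rewrite /z; lra.
Qed.

End Field.

(** * Limits of nodes *)

Definition usc_at (R : realType) (J : R -> \bar R) : Prop :=
  forall t (a : R), (J t < a%:E)%E -> \forall s \near t, (J s < a%:E)%E.

Section Limits.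
Variables (R : realType) (n : nat) (r : nat -> R) (k : R -> \bar R) (sp sn : R -> R).
Variable J : R -> \bar R.
Hypothesis r_gt0 : forall i, 0 < r i.
Hypothesis n_gt0 : (0 < n)%N.
Hypothesis kS : kernel_slopes k sp sn.
Local Notation rho := (\sum_(i < n) r i).
Hypothesis fB : field_bounds n rho k J.
Implicit Types (x y w : nat -> R) (t : R) (j : nat).
Local Notation tsum := (tsum n r k J).
Local Notation imax := (imax n r k J).

Lemma psum_cvg (T : Type) (F : set_system T) (FF : Filter F)
    (u : T -> nat -> R) (s : T -> R) w t :
  (forall i, (i < n)%N -> u z i @[z --> F] --> w i) -> s z @[z --> F] --> t ->
  psum n r k (u z) (s z) @[z --> F] --> psum n r k w t.
Proof.
move=> uw st; apply: (@cvge_sum_lty _ _ _ _ _ _ (fun (i : 'I_n) z => (r i)%:E * k (s z - u z i)%R)%E).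
  by move=> i; apply: lte_mul_pinfty; rewrite ?lee_fin ?ltW //; exact: (ks_lty kS).
move=> i; apply: cvgeZl => //; apply: continuous_cvg; first exact: (ks_cont kS).
by apply: cvgB => //; exact: uw.
Qed.

Lemma tsum_cvg (T : Type) (F : set_system T) (FF : Filter F) (u : T -> nat -> R) w t :
  (forall i, (i < n)%N -> u z i @[z --> F] --> w i) ->
  tsum (u z) t @[z --> F] --> tsum w t.
Proof.
move=> uw; apply: cvgeD; [|exact: cvg_cst|by apply: psum_cvg => //; exact: cvg_cst].
by apply: ltpinfty_adde_def; rewrite inE; [exact: (J_lty fB)|exact: (psum_lty _ r_gt0 kS)].
Qed.

Hypothesis Jusc : usc_at J.

(** The points [s m] stay bounded and converge along [U]. Cell membership is a closed condition, and
    the lower bound passes to the limit because [J] is upper semicontinuous and the kernel sum is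
    jointly continuous. *)
Lemma tsum_limit (U : set_system nat) (UU : UltraFilter U) (u : nat -> nat -> R) w
    (B c : R) (e s : nat -> R) j :
  (forall m i, (i < n)%N -> `|u m i| <= B) ->
  (forall i, (i < n)%N -> u m i @[m --> U] --> w i) -> e @ U --> 0 -> (j <= n)%N ->
  (forall m, ncell n (u m) j (s m)) -> (forall m, ((c - e m)%:E <= tsum (u m) (s m))%E) ->
  exists2 t, ncell n w j t & (c%:E <= tsum w t)%E.
Proof.
move=> uB uw e0 jn sc sF.
(* As [e m < 1] eventually, the values at [s m] exceed [c - 1], whereas beyond [T] they are at most
   [c - 2]. *)
have [T dec] := tsum_decay r_gt0 kS fB B (c - 2).
have smallT : \forall m \near U, - T <= s m <= T.
  have : \forall m \near U, e m < 1 by apply: cvgr_lt e0 _ _; exact: ltr01.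
  apply: filterS => m em; rewrite -ler_norml leNgt; apply/negP => Ts.
  have := le_trans (sF m) (dec (u m) (uB m) (s m) (ltW Ts)).
  by rewrite lee_fin; lra.
have [t st] := ultra_bounded_cvg UU smallT.
exists t.
  split=> [j0|ltjn].
    have jn' : (j.-1 < n)%N by rewrite prednK.
    rewrite -subr_ge0; apply: (cvgr_to_ge (cvgB st (uw _ jn'))).
    by apply: nearW => m; rewrite /= subr_ge0; apply: (sc m).1.
  rewrite -subr_ge0; apply: (cvgr_to_ge (cvgB (uw _ ltjn) st)).
  by apply: nearW => m; rewrite /= subr_ge0; apply: (sc m).2.
rewrite leNgt; apply/negP => Fc.
have [d cd dF] : exists2 d : R, d < c & (tsum w t < d%:E)%E.
  have : ((- c)%:E < - tsum w t)%E by rewrite EFinN lteN2.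
  by move=> /lte_exists_between[d cd dF]; exists (- d); [lra|rewrite EFinN lteNr].
have [a [b [Ja Gb abd]]] := adde_lt_split (J_lty fB t) (psum_lty _ r_gt0 kS w t) dF.
have nJ : \forall m \near U, (J (s m) < a%:E)%E by exact: st (Jusc Ja).
have nG : \forall m \near U, (psum n r k (u m) (s m) < b%:E)%E.
  by apply: cvge_near_lt Gb; exact: psum_cvg.
have ne : \forall m \near U, e m < c - d by apply: cvgr_lt e0 _ _; rewrite subr_gt0.
have [m [[Jm Gm] em]] := filter_ex (filterI (filterI nJ nG) ne).
have := le_lt_trans (sF m) (lteD Jm Gm); rewrite -EFinD lte_fin abd; lra.
Qed.

End Limits.

(** * Maximizers of the smallest local maximum *)

Lemma nondecr_uptoP (R : realType) (n : nat) (y : nat -> R) :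
  (forall i, (i.+1 < n)%N -> y i <= y i.+1) -> nondecr_upto n y.
Proof.
move=> yS i j ij; elim: j ij => [|j IH]; first by rewrite leqn0 => /eqP ->.
rewrite leq_eqVlt => /orP[/eqP -> //|]; rewrite ltnS => ij jn.
by apply: le_trans (IH ij (ltnW jn)) _; exact: yS.
Qed.

Section Maximin.
Variables (R : realType) (n : nat) (r : nat -> R) (k : R -> \bar R) (sp sn : R -> R).
Variable J : R -> \bar R.
Hypothesis r_gt0 : forall i, 0 < r i.
Hypothesis n_gt0 : (0 < n)%N.
Hypothesis kS : kernel_slopes k sp sn.
Local Notation rho := (\sum_(i < n) r i).
Hypothesis fB : field_bounds n rho k J.
Implicit Types (x y w : nat -> R) (t : R) (j : nat).
Local Notation tsum := (tsum n r k J).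
Local Notation imax := (imax n r k J).

Definition level (c : R) : Prop :=
  exists2 y, nondecr_upto n y & forall j, (j <= n)%N -> (c%:E <= imax y j)%E.

Lemma level_le c d : c <= d -> level d -> level c.
Proof.
move=> cd [y ys yd]; exists y => // j jn; apply: le_trans (yd j jn).
by rewrite lee_fin.
Qed.

Lemma ex_level : exists c, level c.
Proof.
have [a a_inc a_fin] := fb_fin fB.
have a_lt i j : (i < j)%N -> (j <= n)%N -> a i < a j.
  elim: j => // j IH; rewrite ltnS leq_eqVlt => /orP[/eqP -> jn|ij jn]; first exact: a_inc.
  by apply: lt_trans (a_inc _ jn); apply: IH => //; exact: ltnW.
(* With nodes at the midpoints, the j-th cell contains [a j], which is no node, so neither [J] nor
   the kernel is -oo there. *)
pose y i := (a i + a i.+1) / 2.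
have ay i : (i < n)%N -> a i < y i by move=> /a_inc; rewrite /y; lra.
have ya i : (i < n)%N -> y i < a i.+1 by move=> /a_inc; rewrite /y; lra.
have aNy i j : (i < n)%N -> (j <= n)%N -> a j - y i != 0.
  move=> ltin jn; rewrite subr_eq0; case: (leqP j i) => ij.
    rewrite lt_eqF //; apply: le_lt_trans (ay i ltin).
    by move: ij; rewrite leq_eqVlt => /orP[/eqP -> //|ji]; apply/ltW/a_lt => //; exact: ltnW.
  rewrite gt_eqF //; apply: lt_le_trans (ya i ltin) _.
  by move: ij; rewrite leq_eqVlt => /orP[/eqP -> //|ji]; apply/ltW/a_lt.
have Ffin j : (j <= n)%N -> tsum y (a j) \is a fin_num.
  move=> jn; rewrite fin_numD a_fin //=; apply/sum_fin_numP => i _ _.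
  by apply: fin_numM => //; apply: (ks_fin kS); exact: aNy.
(* Minus the sum of the absolute values lies below every one of the n + 1 values. *)
exists (- \sum_(j < n.+1) `|fine (tsum y (a j))|), y.
  apply: nondecr_uptoP => i iln; apply/ltW/(lt_trans (ya i (ltnW iln))); exact: ay.
move=> j jn; apply: (@le_trans _ _ (tsum y (a j))).
  rewrite -(fineK (Ffin j jn)) lee_fin.
  have jn1 : (j < n.+1)%N by [].
  rewrite (bigD1 (Ordinal jn1)) //= opprD.
  have := ler_norm (- fine (tsum y (a j))); rewrite normrN.
  have : 0 <= \sum_(i < n.+1 | i != Ordinal jn1) `|fine (tsum y (a i))| by exact: sumr_ge0.
  lra.
apply: imax_ge; split=> [j0|ltjn]; last exact/ltW/ay.
have := ya j.-1; rewrite prednK // => /(_ jn); exact: ltW.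
Qed.

Lemma level_bounded : exists A, forall c, level c -> c <= A.
Proof.
have [B sup] := superlevel_bounded r_gt0 n_gt0 kS fB 0.
have [A bnd] := tsum_bounded r_gt0 kS fB B.
exists (Num.max 0 A) => c [y ys yc]; have [c0|c0] := leP c 0; first by rewrite le_max c0.
rewrite le_max; apply/orP; right; rewrite -lee_fin; apply: le_trans (yc 0%N (leq0n n)) _.
apply: ge_ereal_sup => _ [t _ <-]; apply: bnd; apply: sup => // j jn.
by apply: le_trans (yc j jn); rewrite lee_fin ltW.
Qed.

(** [mu] is the supremum of the real levels. If all local maxima exceeded it, the minimum of
    finitely many reals squeezed between would be a level above the supremum. *)
Lemma ex_maximin_value : exists mu : R,
  (forall y, nondecr_upto n y -> exists2 j, (j <= n)%N & (imax y j <= mu%:E)%E) /\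
  (forall e, 0 < e -> level (mu - e)).
Proof.
have [A Aub] := level_bounded; have [c0 c0l] := ex_level.
have hs : has_sup level by split; [exists c0|exists A].
exists (sup level); split=> [y ys|e e0]; last first.
  have [c cl ec] := sup_adherent e0 hs; exact: level_le (ltW ec) cl.
apply: contrapT => noj.
have all_gt (j : 'I_n.+1) : {c : R | sup level < c & (c%:E < imax y j)%E}.
  apply: cid2; apply: lte_exists_between; rewrite ltNge; apply/negP => h.
  by apply: noj; exists j => //; rewrite -ltnS.
pose c := \big[Num.min/(sup level + 1)]_(j < n.+1) s2val (all_gt j).
have c_gt : sup level < c.
  by apply: lt_bigmin => [|j _]; [rewrite ltrDl|case: (all_gt j)].
have : c <= sup level.
  apply: sup_upper_bound => //; exists y => // j jn.
  have jn1 : (j < n.+1)%N by [].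
  apply: (@le_trans _ _ (s2val (all_gt (Ordinal jn1)))%:E).
    by rewrite lee_fin; exact: bigmin_le_cond.
  by case: (all_gt _) => ? ? /= /ltW.
by rewrite leNgt c_gt.
Qed.

Hypothesis Jusc : usc_at J.

(** Near-maximizers have bounded nodes, hence converge along an ultrafilter, and [tsum_limit]
    handles each cell. Points reaching [mu] are recorded because the perturbation argument evaluates
    the sums there. *)
Lemma ex_maximizer : exists (mu : R) w,
  [/\ nondecr_upto n w,
      forall y, nondecr_upto n y -> exists2 j, (j <= n)%N & (imax y j <= mu%:E)%E
    & forall j, (j <= n)%N -> exists2 t, ncell n w j t & (mu%:E <= tsum w t)%E].
Proof.
have [mu [mu_ub mu_lev]] := ex_maximin_value.
have [U UU ooU] := ultra_oo; have [B sup] := superlevel_bounded r_gt0 n_gt0 kS fB (mu - 1).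
have h0 m : 0 < harmonic m :> R by exact: harmonic_gt0.
have h1 m : harmonic m <= 1 :> R by rewrite /= invf_le1 ?ltr0n // ler1n.
pose u m := s2val (cid2 (mu_lev _ (h0 m))).
have us m : nondecr_upto n (u m) by rewrite /u; case: cid2.
have ul m j : (j <= n)%N -> ((mu - harmonic m)%:E <= imax (u m) j)%E.
  by move=> jn; rewrite /u; case: cid2 => /= y _; apply.
have uB m i : (i < n)%N -> `|u m i| <= B.
  apply: (sup _ (us m)) => j jn; apply: le_trans (ul m j jn).
  by rewrite lee_fin lerD2l lerN2.
have uw i : exists l : R, (i < n)%N -> u m i @[m --> U] --> l.
  case: (ltnP i n) => [ltin|_]; last by exists 0.
  have bnd : \forall m \near U, - B <= u m i <= B.
    by apply: nearW => m; rewrite -ler_norml uB.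
  by have [l ul'] := ultra_bounded_cvg UU bnd; exists l.
pose w i := sval (cid (uw i)).
have uw' i : (i < n)%N -> u m i @[m --> U] --> w i by rewrite /w; case: cid.
have ws : nondecr_upto n w.
  move=> i j ij jn; have ltin := leq_ltn_trans ij jn.
  rewrite -subr_ge0; apply: (cvgr_to_ge (cvgB (uw' _ jn) (uw' _ ltin))).
  by apply: nearW => m; rewrite /= subr_ge0; exact: us.
exists mu, w; split=> // j jn.
(* Doubling the error puts the level strictly below the supremum, so that some point of the cell
   exceeds it. *)
have ex_t m : exists2 t, ncell n (u m) j t & ((mu - harmonic m * 2)%:E <= tsum (u m) t)%E.
  have [|t tc tF] := @imax_gtP _ n r k J (u m) j (mu - harmonic m * 2)%:E.
    by apply: lt_le_trans (ul m j jn); rewrite lte_fin; have := h0 m; lra.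
  by exists t => //; exact: ltW.
pose s m := s2val (cid2 (ex_t m)).
apply: (tsum_limit r_gt0 kS fB Jusc UU uB uw' (e := fun m => harmonic m * 2) (s := s)) => //.
- rewrite -(mul0r 2); apply: cvgMl; apply: cvg_trans (@cvg_harmonic R).
  by move=> A; exact: ooU.
- by move=> m; rewrite /s; case: cid2.
- by move=> m; rewrite /s; case: cid2.
Qed.

End Maximin.

(** * Equioscillation for strictly concave kernels *)

Section Equioscillation.
Variables (R : realType) (n : nat) (r : nat -> R) (k : R -> \bar R) (sp sn : R -> R).
Variable J : R -> \bar R.
Hypothesis r_gt0 : forall i, 0 < r i.
Hypothesis n_gt0 : (0 < n)%N.
Hypothesis kS : kernel_slopes k sp sn.
Local Notation rho := (\sum_(i < n) r i).
Hypothesis fB : field_bounds n rho k J.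
Hypothesis Jusc : usc_at J.
Hypothesis kps : strictly_supporting k sp.
Hypothesis kns : strictly_supporting (fun t => k (- t)) sn.
Local Notation tsum := (tsum n r k J).
Local Notation imax := (imax n r k J).

Section Perturbation.
Variables (mu : R) (w : nat -> R).
Hypothesis ws : nondecr_upto n w.
Hypothesis mu_ub : forall y, nondecr_upto n y -> exists2 j, (j <= n)%N & (imax y j <= mu%:E)%E.
Hypothesis w_att : forall j, (j <= n)%N -> exists2 t, ncell n w j t & (mu%:E <= tsum w t)%E.
Variable j1 : nat.
Hypothesis j1n : (j1 <= n)%N.
Hypothesis j1N : imax w j1 != mu%:E.

(* The minimal local maxima are raised by lowering [height] exactly at their indices:
   [height j] differs from its maximum only there, so the comparison applies there. *)
Let height (j : nat) : R := if imax w j == mu%:E then - 1 else 0.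
Let dir (i : nat) : R := (height i.+1 - height i) / r i.
Let pert (m : nat) (i : nat) : R := w i + harmonic m * dir i.

Let h0 m : 0 < harmonic m :> R. Proof. exact: harmonic_gt0. Qed.

Let imax_ge_mu j : (j <= n)%N -> (mu%:E <= imax w j)%E.
Proof. by move=> jn; have [t tc tF] := w_att jn; apply: le_trans tF (imax_ge _ _ _ tc). Qed.

Let height_le j : -1 <= height j <= 0.
Proof. by rewrite /height; case: ifP => _; lra. Qed.

Let height0 j t : ncell n w j t -> (mu%:E < tsum w t)%E -> height j = 0.
Proof.
move=> tc tF; rewrite /height; case: eqP => // wj; have := imax_ge r k J tc.
by rewrite wj leNgt tF.
Qed.

Let heightN0 j : (j <= n)%N -> height j = 0 -> (mu%:E < imax w j)%E.
Proof.
move=> jn; rewrite /height lt_neqAle imax_ge_mu // andbT eq_sym.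
by case: eqP => // _ /eqP; rewrite oppr_eq0 oner_eq0.
Qed.

(** Division by [r i] in [dir] makes the weighted shift telescope, so D is largest exactly where
    [height] is smallest. *)
Let wshift_pert m l : wshift r w (pert m) l = - (harmonic m * (height l - height 0%N)).
Proof.
elim: l => [|l IH]; first by rewrite /wshift big_geq // subrr mulr0 oppr0.
rewrite wshiftS IH /pert /dir; have := r_gt0 l; move: (r l) => rl rl0; field.
by rewrite gt_eqF.
Qed.

Let pert_argmax m j : (j <= n)%N -> height j = -1 -> wshift_argmax n r w (pert m) j.
Proof.
move=> jn hj; split=> // l _; rewrite !wshift_pert hj lerN2 ler_pM2l //.
by rewrite lerD2r; case/andP: (height_le l).
Qed.

(** Otherwise [height] would be constant; but it is 0 at [j1], and -1 at the index where [mu_ub]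
    bounds a local maximum of [w] by [mu]. *)
Let ex_dir : exists2 i, (i < n)%N & dir i != 0.
Proof.
apply: contrapT => nodir.
have cst l : (l <= n)%N -> height l = height 0%N.
  elim: l => // l IH ln; rewrite -IH; last exact: ltnW.
  apply/eqP; rewrite -subr_eq0; apply/negPn/negP => h; apply: nodir; exists l => //.
  by rewrite mulf_neq0 // invr_neq0 // gt_eqF.
have [j0 j0n j0mu] := mu_ub ws.
have : height j0 = height j1 by rewrite !cst.
rewrite /height (negbTE j1N) ifT; first by move/eqP; rewrite oppr_eq0 oner_eq0.
by rewrite eq_le j0mu imax_ge_mu.
Qed.

Let pert_cvg i : pert m i @[m --> \oo] --> w i.
Proof.
rewrite -[X in _ --> X]addr0; apply: cvgD; first exact: cvg_cst.
by rewrite -(mul0r (dir i)); apply: cvgMl; exact: cvg_harmonic.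
Qed.

(** The strict comparison is applied at a point where [tsum w] is at least [mu], hence finite. *)
Let raise_low m j : nondecr_upto n (pert m) -> (j <= n)%N -> height j = -1 ->
  (mu%:E < imax (pert m) j)%E.
Proof.
move=> ps jn hj; have [t tc tF] := w_att jn; have am := pert_argmax m jn hj.
have [i ltin di] := ex_dir.
have wfin : tsum w t \is a fin_num.
  rewrite fin_numElt (tsum_lty r_gt0 kS fB) andbT.
  by apply: lt_le_trans tF; rewrite ltNyr.
move: wfin; rewrite fin_numD => /andP[Jfin pfin].
apply: (@lt_le_trans _ _ (tsum (pert m) t)); last exact: imax_ge (argmax_cell r_gt0 am tc).
apply: le_lt_trans tF _; rewrite /tsum lteD2lE //.
apply: (@argmax_psum_lt _ _ _ r_gt0 _ _ _ _ ws ps am tc _ _ _ (ks_pos kS) (ks_neg kS) (Ordinal ltin)) => //=.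
rewrite eq_sym -subr_eq0 /pert addrC addKr mulf_neq0 // gt_eqF //; exact: h0.
Qed.

(** Only coinciding nodes could be put in the wrong order. The cell between them is a single point:
    if its [height] is -1, the left node moves left and the right one right, weakly; if it is 0,
    both adjacent cells contain the same high point, so neither node moves. *)
Let near_nondecr : \forall m \near \oo, nondecr_upto n (pert m).
Proof.
have step (i : 'I_n) : \forall m \near \oo, (i.+1 < n)%N -> pert m i <= pert m i.+1.
  case: (ltnP i.+1 n) => [iln|_]; last by apply: nearW.
  have := ws (leqnSn i) iln; rewrite le_eqVlt => /orP[/eqP wi|wi].
    suff dd : dir i <= dir i.+1.
      by apply: nearW => m _; rewrite /pert wi lerD2l ler_wpM2l // ltW.
    have [t [/(_ isT) /= tl /(_ iln) tr] tF] := w_att (ltnW iln).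
    have tE : t = w i by apply/le_anti; rewrite tl wi tr.
    have ri : 0 < (r i)^-1 by rewrite invr_gt0.
    have ri1 : 0 < (r i.+1)^-1 by rewrite invr_gt0.
    have /andP[hi hi'] := height_le i; have /andP[hj hj'] := height_le i.+1.
    have /andP[hl hl'] := height_le i.+2.
    have [hN1|h0'] : height i.+1 = -1 \/ height i.+1 = 0.
      by rewrite /height; case: ifP; [left|right].
    - rewrite /dir hN1; apply: (@le_trans _ _ 0).
        by apply: mulr_le0_ge0; [lra|exact: ltW].
      by apply: mulr_ge0; [lra|exact: ltW].
    - have [t' [/(_ isT) /= tl' /(_ iln) tr'] tF'] := imax_gtP (heightN0 (ltnW iln) h0').
      have t'E : t' = w i by apply/le_anti; rewrite tl' wi tr'.
      rewrite t'E in tF'.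
      have hi0 : height i = 0.
        apply: height0 tF'; split=> [i0|_] //; apply: ws; [exact: leq_pred|exact: ltn_ord].
      have hi20 : height i.+2 = 0.
        by apply: height0 tF'; split=> [_|i2n] /=; rewrite wi //; apply: ws.
      by rewrite /dir hi0 h0' hi20 subrr !mul0r.
  have wi0 : 0 < w i.+1 - w i by rewrite subr_gt0.
  apply: filterS (cvgr_gt _ (cvgB (@pert_cvg i.+1) (@pert_cvg i)) _ wi0) => m + _.
  by rewrite /= subr_gt0 => /ltW.
have steps : \forall m \near \oo, forall i : 'I_n, (i.+1 < n)%N -> pert m i <= pert m i.+1.
  exact: filter_forall step.
apply: filterS steps => m pm; apply: nondecr_uptoP => i iln.
exact: (pm (Ordinal (ltnW iln))).
Qed.

(** A point with value above [mu] keeps such a value under small shifts. If it is an endpoint of its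
    cell, the neighbouring cell contains it and is high too, so that node is fixed; otherwise the
    node stays on its side of the point. *)
Let near_keep_high (j : 'I_n.+1) : \forall m \near \oo, height j = 0 -> (mu%:E < imax (pert m) j)%E.
Proof.
have jn : (j <= n)%N by rewrite -ltnS.
have [hj|hj] := eqVneq (height j) 0; last first.
  by apply: nearW => m hj0; rewrite hj0 eqxx in hj.
have [t [tl tr] tF] := imax_gtP (heightN0 jn hj).
have Fcvg : tsum (pert m) t @[m --> \oo] --> tsum w t.
  by apply: (tsum_cvg r_gt0 kS fB) => i _; exact: pert_cvg.
have nF := cvge_near_gt Fcvg tF.
have nl : \forall m \near \oo, (0 < j)%N -> pert m j.-1 <= t.
  case: (posnP j) => [_|j0]; first by apply: nearW.
  have := tl j0; rewrite le_eqVlt => /orP[/eqP wt|wt].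
    have hj1 : height j.-1 = 0.
      apply: height0 tF; split=> [j1'|_]; last by rewrite wt.
      by rewrite -wt; apply: ws; [exact: leq_pred|rewrite prednK].
    by apply: nearW => m _; rewrite /pert /dir prednK // hj1 hj subrr mul0r mulr0 addr0 wt.
  by apply: filterS (cvgr_lt _ (@pert_cvg j.-1) _ wt) => m /ltW.
have nr : \forall m \near \oo, (j < n)%N -> t <= pert m j.
  case: (ltnP j n) => [ltjn|_]; last by apply: nearW.
  have := tr ltjn; rewrite le_eqVlt => /orP[/eqP wt|wt].
    have hj1 : height j.+1 = 0.
      apply: height0 tF; split=> [_|j1']; first by rewrite wt.
      by rewrite wt; apply: ws.
    by apply: nearW => m _; rewrite /pert /dir hj1 hj subrr mul0r mulr0 addr0 wt.
  by apply: filterS (cvgr_gt _ (@pert_cvg j) _ wt) => m /ltW.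
apply: filterS3 nF nl nr => m mF ml mr _.
by apply: lt_le_trans mF _; apply: imax_ge.
Qed.

Lemma maximizer_contra : False.
Proof.
have keep : \forall m \near \oo, forall j : 'I_n.+1, height j = 0 -> (mu%:E < imax (pert m) j)%E.
  exact: filter_forall near_keep_high.
have [m [ps high]] := filter_ex (filterI near_nondecr keep).
have [j jn] := mu_ub ps; apply/negP; rewrite -ltNge.
have jn1 : (j < n.+1)%N by [].
have [hN1|h0'] : height j = -1 \/ height j = 0.
  by rewrite /height; case: ifP; [left|right].
- exact: raise_low.
- exact: (high (Ordinal jn1)).
Qed.

End Perturbation.

Lemma ex_equioscillation_strict : exists (mu : R) w,
  [/\ nondecr_upto n w,
      forall y, nondecr_upto n y -> exists2 j, (j <= n)%N & (imax y j <= mu%:E)%E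
    & forall j, (j <= n)%N -> imax w j = mu%:E].
Proof.
have [mu [w [ws mu_ub w_att]]] := ex_maximizer r_gt0 n_gt0 kS fB Jusc.
exists mu, w; split=> // j jn; apply/eqP/negPn/negP => jN.
exact: (maximizer_contra ws mu_ub w_att jn jN).
Qed.

End Equioscillation.

(** * Equioscillation for upper semicontinuous fields *)

Lemma ex_ncell (R : realType) (n : nat) (y : nat -> R) (t : R) :
  exists2 j, (j <= n)%N & ncell n y j t.
Proof.
have exj : exists j, (j == n) || (t <= y j) by exists n; rewrite eqxx.
case: (ex_minnP exj) => j jP jmin; exists j.
  by apply: jmin; rewrite eqxx.
split=> [j0|ltjn]; last by move: jP; rewrite ltn_eqF.
rewrite leNgt; apply/negP => /ltW h; have := jmin j.-1; rewrite h orbT => /(_ isT).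
by rewrite leqNgt prednK // leqnn.
Qed.

Section Damping.
Variables (R : realType) (k : R -> \bar R) (sp sn : R -> R) (e : R).
Hypothesis e_gt0 : 0 < e.
Hypothesis kS : kernel_slopes k sp sn.

(* Unlike 1 / |u|, this term is bounded, so the damped kernels converge uniformly and stay
   nonsingular if [k] is. *)
Definition damp (u : R) : R := e / (1 + `|u|).
Definition damped (u : R) : \bar R := (k u + (- damp u)%:E)%E.
Definition damped_slope (s : R -> R) (b : R) : R := s b + e / (1 + b) ^+ 2.

Lemma damp_ge0 u : 0 <= damp u.
Proof. by rewrite divr_ge0 // ?ltW // addr_ge0. Qed.

Lemma damp_le u : damp u <= e.
Proof. by rewrite ler_pdivrMr ?ltr_pwDl // ler_pMr // lerDl. Qed.

(** The gap between the tangent of [- damp] at b and its value at a, in a form that is visibly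
    positive for a different from b. *)
Lemma damp_gap a b : 0 <= a -> 0 < b ->
  e / (1 + b) ^+ 2 * (a - b) + damp a - damp b = e * (a - b) ^+ 2 / ((1 + a) * (1 + b) ^+ 2).
Proof.
move=> a0 b0; rewrite /damp (ger0_norm a0) (gtr0_norm b0); field.
by apply/andP; split; apply/eqP; lra.
Qed.

Lemma damped_supporting (h : R -> \bar R) (s : R -> R) :
  (forall b, 0 < b -> h b \is a fin_num) -> supporting h s ->
  supporting (fun u => h u + (- damp u)%:E)%E (damped_slope s) /\
  strictly_supporting (fun u => h u + (- damp u)%:E)%E (damped_slope s).
Proof.
move=> hfin [s0 sdec sup].
have gap a b : 0 <= a -> 0 < b -> exists g,
    [/\ 0 <= g, a != b -> 0 < g &
     damped_slope s b * (a - b) + - damp b = s b * (a - b) + - damp a + g].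
  move=> a0 b0; exists (e * (a - b) ^+ 2 / ((1 + a) * (1 + b) ^+ 2)); split.
  - by rewrite divr_ge0 // mulr_ge0 ?sqr_ge0 //; [exact: ltW|lra].
  - move=> ab; have ab2 : 0 < (a - b) ^+ 2 by rewrite exprn_even_gt0 //= subr_eq0.
    have a1 : 0 < 1 + a by lra.
    have b1 : 0 < 1 + b by lra.
    by apply: divr_gt0; apply: mulr_gt0 => //; exact: exprn_gt0.
  - by rewrite -damp_gap // /damped_slope; ring.
split; first split.
- by move=> b b0; rewrite addr_ge0 ?s0 // divr_ge0 ?sqr_ge0 // ltW.
- move=> a b a0 ab; apply: lerD; first exact: sdec.
  apply: ler_wpM2l; first exact: ltW.
  rewrite lef_pV2 ?posrE; [|by apply: exprn_gt0; lra|by apply: exprn_gt0; lra].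
  by rewrite ler_pXn2r ?nnegrE ?lerD2l //; lra.
- move=> a b a0 b0; have [g [g0 _ gE]] := gap a b a0 b0.
  rewrite -addeA -EFinD [(- damp b + _)%R]addrC gE.
  apply: (@le_trans _ _ (h b + (s b * (a - b))%:E + (- damp a)%:E)%E).
    by apply: leeD2r; exact: sup.
  by rewrite -addeA -EFinD; apply: leeD2l; rewrite lee_fin; lra.
move=> a b a0 b0 ab; have [g [_ /(_ ab) g0 gE]] := gap a b a0 b0.
rewrite -addeA -EFinD [(- damp b + _)%R]addrC gE.
have := sup a b a0 b0; have := hfin b b0; case: (h b) => // hb _.
case: (h a) => [ha| |] //; last by rewrite addNye -EFinD ltNyr.
by rewrite -!EFinD lee_fin lte_fin; lra.
Qed.

Lemma damped_slopes : kernel_slopes damped (damped_slope sp) (damped_slope sn) /\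
  strictly_supporting damped (damped_slope sp) /\
  strictly_supporting (fun u => damped (- u)) (damped_slope sn).
Proof.
have [pos pos'] : supporting damped (damped_slope sp) /\ strictly_supporting damped (damped_slope sp).
  by apply: damped_supporting (ks_pos kS) => b b0; apply: (ks_fin kS); rewrite gt_eqF.
have [neg neg'] : supporting (fun u => damped (- u)) (damped_slope sn) /\
    strictly_supporting (fun u => damped (- u)) (damped_slope sn).
  have -> : (fun u => damped (- u)) = (fun u => k (- u) + (- damp u)%:E)%E.
    by apply/funext => u; rewrite /damped /damp normrN.
  by apply: damped_supporting (ks_neg kS) => b b0; apply: (ks_fin kS); rewrite oppr_eq0 gt_eqF.
split; last by [].
split=> //.
- move=> u; apply: cvgeD; [exact: fin_num_adde_defl|exact: (ks_cont kS)|].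
  apply: cvg_EFin; first by apply: nearW.
  apply: cvgN; apply: cvgMr; apply: cvgV; first by rewrite gt_eqF // ltr_pwDl.
  by apply: cvgD; [exact: cvg_cst|exact: cvg_norm].
- by move=> u u0; rewrite fin_numD (ks_fin kS).
- by move=> u; apply: lte_add_pinfty; [exact: (ks_lty kS)|rewrite ltry].
Qed.

Variables (n : nat) (r : nat -> R) (J : R -> \bar R).
Hypothesis r_gt0 : forall i, 0 < r i.
Local Notation rho := (\sum_(i < n) r i).

Lemma damped_field_bounds : field_bounds n rho k J -> field_bounds n rho damped J.
Proof.
case=> ub adm fin; split=> // A; have [T admT] := adm A; exists T => t /admT.
apply: le_trans; apply: leeD2l; apply: lee_wpmul2l.
  by rewrite lee_fin; apply: sumr_ge0 => i _; exact: ltW.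
by rewrite geeDl // lee_fin oppr_le0 damp_ge0.
Qed.

Lemma damped_tsum y t :
  (tsum n r damped J y t <= tsum n r k J y t <= tsum n r damped J y t + (e * rho)%:E)%E.
Proof.
have psumE : psum n r damped y t = (psum n r k y t + (- \sum_(i < n) r i * damp (t - y i))%:E)%E.
  rewrite /psum -sumrN -sumEFin -big_split /=; apply: eq_bigr => i _.
  by rewrite muleDr // ?fin_num_adde_defl // -EFinM mulrN.
have d0 : 0 <= \sum_(i < n) r i * damp (t - y i).
  by apply: sumr_ge0 => i _; rewrite mulr_ge0 ?damp_ge0 // ltW.
have de : \sum_(i < n) r i * damp (t - y i) <= e * rho.
  by rewrite mulr_sumr; apply: ler_sum => i _; rewrite mulrC ler_wpM2r ?damp_le // ltW.
rewrite /tsum psumE; apply/andP; split.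
  by apply: leeD2l; rewrite geeDl // lee_fin oppr_le0.
rewrite -!addeA; apply: leeD2l; rewrite -EFinD leeDl // lee_fin; lra.
Qed.

Lemma damped_imax y j :
  (imax n r damped J y j <= imax n r k J y j <= imax n r damped J y j + (e * rho)%:E)%E.
Proof.
apply/andP; split; apply: ge_ereal_sup => _ [t tc <-].
  by have /andP[h _] := damped_tsum y t; apply: le_trans h (imax_ge _ _ _ tc).
have /andP[_ h] := damped_tsum y t; apply: le_trans h _.
by apply: leeD2r; exact: imax_ge.
Qed.

End Damping.

Section EquioscillationUsc.
Variables (R : realType) (n : nat) (r : nat -> R) (k : R -> \bar R) (sp sn : R -> R).
Variable J : R -> \bar R.
Hypothesis r_gt0 : forall i, 0 < r i.
Hypothesis n_gt0 : (0 < n)%N.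
Hypothesis kS : kernel_slopes k sp sn.
Local Notation rho := (\sum_(i < n) r i).
Hypothesis fB : field_bounds n rho k J.
Hypothesis Jusc : usc_at J.
Local Notation tsum := (tsum n r k J).

(** Equioscillation points for the damped kernels have common values tending to [mu] and bounded
    nodes. Their limit along an ultrafilter equioscillates for [k] itself. *)
Lemma ex_equioscillation : exists (mu : R) w,
  nondecr_upto n w /\ forall j, (j <= n)%N -> imax n r k J w j = mu%:E.
Proof.
have [mu [mu_ub mu_lev]] := ex_maximin_value r_gt0 n_gt0 kS fB.
have rho0 : 0 < rho := rho_gt0 r_gt0 n_gt0.
have h0 m : 0 < harmonic m :> R by exact: harmonic_gt0.
have h1 m : harmonic m <= 1 :> R by rewrite /= invf_le1 ?ltr0n // ler1n.
pose kd m := damped k (harmonic m).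
(* In the factor [1 + rho], 1 accounts for a nearly optimal [y] and [rho] for the loss caused by
   damping. *)
have ex_w m : exists2 w, nondecr_upto n w & exists nu : R,
    [/\ mu - harmonic m * (1 + rho) <= nu, nu <= mu &
     forall j, (j <= n)%N -> imax n r (kd m) J w j = nu%:E].
  have [kdS [kdp kdn]] := damped_slopes (h0 m) kS.
  have fBd := damped_field_bounds (h0 m) r_gt0 fB.
  have dmp := damped_imax k (h0 m) n J r_gt0.
  have [nu [w [ws nu_ub w_nu]]] := ex_equioscillation_strict r_gt0 n_gt0 kdS fBd Jusc kdp kdn.
  exists w => //; exists nu; split=> //.
    have [y ys ymu] := mu_lev _ (h0 m); have [j jn ynu] := nu_ub y ys.
    have := ymu j jn; have /andP[_ h] := dmp y j => /le_trans /(_ h) h'.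
    have := le_trans h' (leeD2r _ ynu); rewrite -EFinD lee_fin; lra.
  have [j jn wmu] := mu_ub w ws; have /andP[h _] := dmp w j.
  by rewrite -lee_fin -(w_nu j jn); exact: le_trans wmu.
pose w m := s2val (cid2 (ex_w m)).
have ws m : nondecr_upto n (w m) by rewrite /w; case: cid2.
have w_lb m j : (j <= n)%N -> ((mu - harmonic m * (1 + rho))%:E <= imax n r k J (w m) j)%E.
  move=> jn; rewrite /w; case: cid2 => /= y _ [nu [nul _ ynu]].
  have /andP[h _] := damped_imax k (h0 m) n J r_gt0 y j; apply: le_trans h.
  by rewrite ynu // lee_fin.
have w_ub m t : (tsum (w m) t <= (mu + harmonic m * rho)%:E)%E.
  rewrite /w; case: cid2 => /= y _ [nu [_ nul ynu]].
  have [j jn tc] := ex_ncell n y t; apply: le_trans (imax_ge _ _ _ tc) _.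
  have /andP[_ h] := damped_imax k (h0 m) n J r_gt0 y j; apply: le_trans h _.
  by rewrite ynu // -EFinD lee_fin lerD2r.
have [U UU ooU] := ultra_oo.
have [B sup] := superlevel_bounded r_gt0 n_gt0 kS fB (mu - (1 + rho)).
have wB m i : (i < n)%N -> `|w m i| <= B.
  apply: (sup _ (ws m)) => j jn; apply: le_trans (w_lb m j jn).
  by rewrite lee_fin lerD2l lerN2 ler_piMl // addr_ge0 // ltW.
have wl i : exists l : R, (i < n)%N -> w m i @[m --> U] --> l.
  case: (ltnP i n) => [ltin|_]; last by exists 0.
  have bnd : \forall m \near U, - B <= w m i <= B.
    by apply: nearW => m; rewrite -ler_norml wB.
  by have [l ul'] := ultra_bounded_cvg UU bnd; exists l.
pose v i := sval (cid (wl i)).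
have wv i : (i < n)%N -> w m i @[m --> U] --> v i by rewrite /v; case: cid.
have vs : nondecr_upto n v.
  move=> i j ij jn; have ltin := leq_ltn_trans ij jn.
  rewrite -subr_ge0; apply: (cvgr_to_ge (cvgB (wv _ jn) (wv _ ltin))).
  by apply: nearW => m; rewrite /= subr_ge0; exact: ws.
have hU (c : R) : harmonic m * c @[m --> U] --> 0.
  rewrite -(mul0r c); apply: cvgMl; apply: cvg_trans (@cvg_harmonic R).
  by move=> A; exact: ooU.
exists mu, v; split=> // j jn; apply/eqP; rewrite eq_le; apply/andP; split; last first.
  have ex_t m : exists2 t, ncell n (w m) j t & ((mu - harmonic m * (2 + rho))%:E <= tsum (w m) t)%E.
    have [|t tc tF] := @imax_gtP _ n r k J (w m) j (mu - harmonic m * (2 + rho))%:E.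
      by apply: lt_le_trans (w_lb m j jn); rewrite lte_fin; have := h0 m; lra.
    by exists t => //; exact: ltW.
  pose s m := s2val (cid2 (ex_t m)).
  have [||t tc tF] := tsum_limit r_gt0 kS fB Jusc UU wB wv (hU (2 + rho)) jn (s := s) (c := mu).
  - by move=> m; rewrite /s; case: cid2.
  - by move=> m; rewrite /s; case: cid2.
  - exact: le_trans tF (imax_ge _ _ _ tc).
(* The bound [w_ub] holds at every t whatever its cell, so for fixed t it passes to the limit by
   continuity in the nodes alone. *)
apply: ge_ereal_sup => _ [t _ <-]; rewrite leNgt; apply/negP => /lte_exists_between[d mud dF].
have nF : \forall m \near U, (d%:E < tsum (w m) t)%E.
  by apply: cvge_near_gt dF; apply: (tsum_cvg r_gt0 kS fB).
have ne : \forall m \near U, harmonic m * rho < d - mu.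
  by apply: cvgr_lt (hU rho) _ _; rewrite subr_gt0.
have [m [mF me]] := filter_ex (filterI nF ne).
have := lt_le_trans mF (w_ub m t); rewrite lte_fin; lra.
Qed.

End EquioscillationUsc.

(** * The upper semicontinuous envelope of the field *)

Lemma lte_exists_below (R : realType) (b : \bar R) (x : R) : (b < x%:E)%E ->
  exists2 c : R, (b <= c%:E)%E & c < x.
Proof.
case: b => [b| |] //; last by move=> _; exists (x - 1); [exact: leNye|lra].
by rewrite lte_fin => bx; exists ((b + x) / 2); [rewrite lee_fin|]; lra.
Qed.

(** The neighbourhoods are not punctured, so the value [J t] itself counts. *)
Definition usc_env (R : realType) (J : R -> \bar R) (t : R) : \bar R := limf_esup J (nbhs t).

Section Envelope.
Variables (R : realType) (J : R -> \bar R).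

Lemma usc_env_ge t : (J t <= usc_env J t)%E.
Proof.
rewrite /usc_env limf_esupE; apply: le_ereal_inf_tmp => _ [V tV <-].
by apply: ereal_sup_ubound; exists t => //; exact: nbhs_singleton.
Qed.

Lemma usc_env_le_sup (V : set R) t : nbhs t V -> (usc_env J t <= ereal_sup (J @` V))%E.
Proof. by move=> tV; rewrite /usc_env limf_esupE; apply: ereal_inf_lbound; exists V. Qed.

Lemma usc_env_usc : usc_at (usc_env J).
Proof.
move=> t a; rewrite /usc_env limf_esupE => /ereal_inf_lt[_ [V tV <-] Va].
apply: filterS (nbhs_interior tV) => s sV.
by apply: le_lt_trans Va; apply: usc_env_le_sup.
Qed.

Lemma usc_env_gt (c : \bar R) t (V : set R) : (c < usc_env J t)%E -> nbhs t V ->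
  exists2 s, V s & (c < J s)%E.
Proof.
move=> ct tV; have := lt_le_trans ct (usc_env_le_sup tV).
by case/ereal_sup_gt => _ [s Vs <-] cs; exists s.
Qed.

Hypothesis J_ub : exists C : R, forall t, (J t <= C%:E)%E.

Lemma usc_env_ub : exists C : R, forall t, (usc_env J t <= C%:E)%E.
Proof.
have [C JC] := J_ub; exists C => t; apply: le_trans (usc_env_le_sup (filterT : nbhs t setT)) _.
by apply: ge_ereal_sup => _ [s _ <-].
Qed.

(** Each [t] is moved to a nearby point where [J] almost reaches its envelope at [t]. The choices at
    different points are unrelated, but any finite set of points can be treated with the same m. *)
Lemma ex_usc_env_approx : exists p : nat -> R -> R,
  (forall t, p m t @[m --> \oo] --> t) /\
  (forall t (a : R), (a%:E < usc_env J t)%E -> \forall m \near \oo, (a%:E < J (p m t))%E).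
Proof.
have h0 m : 0 < harmonic m :> R by exact: harmonic_gt0.
(* Where the envelope is -oo there is nothing to approximate and [t] stays in place. *)
have ex_s m t : exists s : R, `|t - s| < harmonic m /\
    (usc_env J t \is a fin_num -> (usc_env J t - (harmonic m)%:E < J s)%E).
  have [fin|_] := boolP (usc_env J t \is a fin_num); last first.
    by exists t; rewrite subrr normr0.
  have [|s ts sJ] := @usc_env_gt (usc_env J t - (harmonic m)%:E)%E t _ _ (nbhsx_ballx t _ (h0 m)).
    by rewrite lteBlDr // lteDl // lte_fin.
  by exists s.
pose p m t := sval (cid (ex_s m t)).
have pP m t : `|t - p m t| < harmonic m /\
    (usc_env J t \is a fin_num -> (usc_env J t - (harmonic m)%:E < J (p m t))%E).
  by rewrite /p; case: cid.
have hcvg : (harmonic : nat -> R) @ \oo --> 0 by exact: cvg_harmonic.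
exists p; split=> [t|t a aJ].
  apply/cvgrPdist_lt => e e0.
  by apply: filterS (cvgr_lt _ hcvg _ e0) => m; apply: lt_trans; case: (pP m t).
have fin : usc_env J t \is a fin_num.
  have [C JC] := usc_env_ub; rewrite fin_numElt (lt_trans _ aJ) ?ltNyr //=.
  by apply: le_lt_trans (JC t) _; rewrite ltry.
move: aJ; rewrite -(fineK fin) lte_fin -subr_gt0 => aJ.
apply: filterS (cvgr_lt _ hcvg _ aJ) => m hm.
have [_ /(_ fin)] := pP m t; apply: le_lt_trans.
by rewrite -{1}(fineK fin) -EFinB lee_fin; lra.
Qed.

End Envelope.

Section EnvelopeTransfer.
Variables (R : realType) (n : nat) (r : nat -> R) (k : R -> \bar R) (sp sn : R -> R).
Variable J : R -> \bar R.
Hypothesis r_gt0 : forall i, 0 < r i.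
Hypothesis n_gt0 : (0 < n)%N.
Hypothesis kS : kernel_slopes k sp sn.
Local Notation rho := (\sum_(i < n) r i).
Hypothesis fB : field_bounds n rho k J.

Lemma usc_env_field_bounds : field_bounds n rho k (usc_env J).
Proof.
have [C JC] := usc_env_ub (fb_ub fB).
split; first by exists C.
(* The margin 1 keeps points near [t] beyond [T0], where admissibility of [J] itself contradicts a
   larger envelope. *)
- move=> A; have [T0 adm] := fb_adm fB A; exists (Num.max 1 (T0 + 1)) => t.
  rewrite ge_max => /andP[t1 tT]; rewrite leNgt; apply/negP => gtA.
  have t0 : t != 0 by rewrite -normr_gt0; lra.
  have ltyk u : (rho%:E * k u < +oo)%E.
    by apply: lte_mul_pinfty; rewrite ?lee_fin ?(ks_lty kS) // ltW // rho_gt0.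
  have envlty : (usc_env J t < +oo)%E by apply: le_lt_trans (JC t) _; rewrite ltry.
  have [a [b [aJ bk abA]]] := adde_gt_split envlty (ltyk t) gtA.
  have kcvg : (rho%:E * k s)%E @[s --> t] --> (rho%:E * k t)%E.
    by apply: cvgeZl => //; exact: (ks_cont kS).
  have nk := cvge_near_gt kcvg bk.
  have nT : \forall s \near t, T0 <= `|s|.
    have tT' : T0 < `|t| by lra.
    by apply: filterS (cvgr_gt _ (@norm_continuous _ _ t) _ tT') => s /ltW.
  have [s [sk sT] sJ] := usc_env_gt aJ (filterI nk nT).
  have := lt_le_trans (lteD sJ sk) (adm s sT).
  by rewrite -EFinD abA ltxx.
- have [a a_inc a_fin] := fb_fin fB; exists a => // i ltin.
  rewrite fin_numElt (le_lt_trans (JC _)) ?ltry // andbT.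
  apply: lt_le_trans (usc_env_ge _ _); have := a_fin i ltin.
  by rewrite fin_numElt => /andP[].
Qed.

Let Jlty t : (usc_env J t < +oo)%E.
Proof. exact: (J_lty usc_env_field_bounds). Qed.

Lemma tsum_usc_env_ge y t : (tsum n r k J y t <= tsum n r k (usc_env J) y t)%E.
Proof. by apply: leeD2r; exact: usc_env_ge. Qed.

Lemma imax_usc_env_ge y j : (imax n r k J y j <= imax n r k (usc_env J) y j)%E.
Proof.
apply: ge_ereal_sup => _ [t tc <-]; apply: le_trans (tsum_usc_env_ge y t) _.
exact: imax_ge.
Qed.

Lemma near_tsum_usc_env (p : nat -> R -> R) (u : nat -> nat -> R) y t (c : R) :
  (forall t, p m t @[m --> \oo] --> t) ->
  (forall t (a : R), (a%:E < usc_env J t)%E -> \forall m \near \oo, (a%:E < J (p m t))%E) ->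
  (forall i, (i < n)%N -> u m i @[m --> \oo] --> y i) ->
  (c%:E < tsum n r k (usc_env J) y t)%E ->
  \forall m \near \oo, (c%:E < tsum n r k J (u m) (p m t))%E.
Proof.
move=> pt pJ uy cF.
have [a [b [aJ bG abc]]] := adde_gt_split (Jlty t) (psum_lty _ r_gt0 kS y t) cF.
have nG : \forall m \near \oo, (b%:E < psum n r k (u m) (p m t))%E.
  apply: cvge_near_gt bG; exact: psum_cvg r_gt0 kS _ _ _ _ _ _ _ uy (pt t).
apply: filterS2 (pJ t a aJ) nG => m Jm Gm.
by rewrite -abc EFinD; exact: lteD.
Qed.

(** With a singular kernel, a point where the sum is finite is no node. It is therefore interior to
    its cell, and small moves towards better values of [J] stay in the cell. *)
Lemma imax_usc_env y j : k 0 = -oo%E -> nondecr_upto n y -> (j <= n)%N ->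
  imax n r k (usc_env J) y j = imax n r k J y j.
Proof.
move=> k0 ys jn; apply/eqP; rewrite eq_le imax_usc_env_ge andbT leNgt; apply/negP.
case/imax_gtP => t [tl tr] tF.
have fin : tsum n r k (usc_env J) y t \is a fin_num.
  rewrite fin_numElt (tsum_lty r_gt0 kS usc_env_field_bounds) andbT.
  by apply: le_lt_trans tF; rewrite leNye.
have tNy i : (i < n)%N -> t != y i.
  move=> ltin; apply/eqP => ty; move: fin; rewrite fin_numD => /andP[_ /sum_fin_numP].
  move=> /(_ (Ordinal ltin) (mem_index_enum _) isT) /=.
  by rewrite ty subrr k0 gt0_muleNy ?lte_fin.
rewrite -(fineK fin) in tF; have [c cI cF] := lte_exists_below tF.
rewrite -lte_fin fineK // in cF.
have [p [pt pJ]] := ex_usc_env_approx (fb_ub fB).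
have nF : \forall m \near \oo, (c%:E < tsum n r k J y (p m t))%E.
  by apply: (near_tsum_usc_env pt pJ _ cF) => i _; exact: cvg_cst.
have nl : \forall m \near \oo, (0 < j)%N -> y j.-1 <= p m t.
  case: (posnP j) => [_|j0]; first by apply: nearW.
  have yt : y j.-1 < t by rewrite lt_neqAle eq_sym tNy ?tl // prednK.
  by apply: filterS (cvgr_gt _ (pt t) _ yt) => m /ltW.
have nr : \forall m \near \oo, (j < n)%N -> p m t <= y j.
  case: (ltnP j n) => [ltjn|_]; last by apply: nearW.
  have yt : t < y j by rewrite lt_neqAle tNy ?tr.
  by apply: filterS (cvgr_lt _ (pt t) _ yt) => m /ltW.
have [m [[mF ml] mr]] := filter_ex (filterI (filterI nF nl) nr).
by have := lt_le_trans mF (imax_ge r k J (conj ml mr)); rewrite ltNge cI.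
Qed.

(* Moving nodes and evaluation points by the same map [p m] keeps coinciding ones together,
   so cells reduced to a point, or attaining their supremum at an endpoint, lose nothing. *)
Lemma level_usc_env (mu c : R) w : nondecr_upto n w ->
  (forall j, (j <= n)%N -> imax n r k (usc_env J) w j = mu%:E) -> c < mu -> level n r k J c.
Proof.
move=> ws wmu cmu.
have [p [pt pJ]] := ex_usc_env_approx (fb_ub fB).
have near_le a b : a <= b -> \forall m \near \oo, p m a <= p m b.
  rewrite le_eqVlt => /orP[/eqP ->|ab]; first by apply: nearW.
  have ab0 : 0 < b - a by rewrite subr_gt0.
  apply: filterS (cvgr_gt _ (cvgB (pt b) (pt a)) _ ab0) => m.
  by rewrite /= subr_gt0 => /ltW.
have nmono : \forall m \near \oo, forall i : 'I_n, (i.+1 < n)%N -> p m (w i) <= p m (w i.+1).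
  apply: filter_forall => i; case: (ltnP i.+1 n) => [iln|_]; last by apply: nearW.
  by apply: filterS (near_le _ _ (ws _ _ (leqnSn i) iln)) => m.
have ncells : \forall m \near \oo, forall j : 'I_n.+1,
    (c%:E <= imax n r k J (fun i => p m (w i)) j)%E.
  apply: filter_forall => j.
  have [|t [tl tr] tF] := @imax_gtP _ n r k (usc_env J) w j c%:E.
    by rewrite wmu ?lte_fin // -ltnS.
  have nF : \forall m \near \oo, (c%:E < tsum n r k J (fun i => p m (w i)) (p m t))%E.
    by apply: (near_tsum_usc_env pt pJ _ tF) => i _; exact: pt.
  have nl : \forall m \near \oo, (0 < j)%N -> p m (w j.-1) <= p m t.
    case: (posnP j) => [_|j0]; first by apply: nearW.
    by apply: filterS (near_le _ _ (tl j0)) => m.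
  have nr : \forall m \near \oo, (j < n)%N -> p m t <= p m (w j).
    case: (ltnP j n) => [ltjn|_]; last by apply: nearW.
    by apply: filterS (near_le _ _ (tr ltjn)) => m.
  apply: filterS3 nF nl nr => m mF ml mr; apply: le_trans (ltW mF) _.
  exact: (imax_ge r k J (conj ml mr)).
have [m [mono cells]] := filter_ex (filterI nmono ncells).
exists (fun i => p m (w i)).
  by apply: nondecr_uptoP => i iln; exact: (mono (Ordinal (ltnW iln))).
move=> j jn; have jn1 : (j < n.+1)%N by [].
exact: (cells (Ordinal jn1)).
Qed.

End EnvelopeTransfer.

(** * Supporting lines of concave kernels *)

Section Slopes.
Variables (R : realType) (f : R -> R).
Hypothesis f_mono : forall x y, 0 < x -> x <= y -> f x <= f y.
Hypothesis f_conc : forall x y a, 0 < x -> 0 < y -> 0 <= a -> a <= 1 ->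
  a * f x + (1 - a) * f y <= f (a * x + (1 - a) * y).

Let slope u v := (f v - f u) / (v - u).

Lemma three_slopes u v w : 0 < u -> u < v -> v < w ->
  (f w - f v) * (v - u) <= (f v - f u) * (w - v).
Proof.
move=> u0 uv vw; have wu : 0 < w - u by lra.
(* The weight that represents v as a convex combination of u and w. *)
pose a := (w - v) / (w - u).
have a0 : 0 <= a by rewrite divr_ge0 //; lra.
have a1 : a <= 1 by rewrite ler_pdivrMr //; lra.
have w0 : 0 < w by lra.
have := f_conc u0 w0 a0 a1.
have -> : a * u + (1 - a) * w = v by rewrite /a; field; rewrite gt_eqF.
have aE : a * (w - u) = w - v by rewrite /a divfK // gt_eqF.
move=> h; have := ler_wpM2r (ltW wu) h.
have -> : (a * f u + (1 - a) * f w) * (w - u) = (w - v) * f u + (v - u) * f w.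
  have -> : (a * f u + (1 - a) * f w) * (w - u) = a * (w - u) * f u + (w - u - a * (w - u)) * f w.
    by ring.
  by rewrite aE; ring.
by move=> {}h; rewrite -subr_ge0; move: h; rewrite -subr_ge0; congr (0 <= _); ring.
Qed.

Lemma slope_le u v w : 0 < u -> u < v -> v < w -> slope v w <= slope u v.
Proof.
move=> u0 uv vw; rewrite /slope ler_pdivrMr ?subr_gt0 // mulrAC ler_pdivlMr ?subr_gt0 //.
exact: three_slopes.
Qed.

(** The right derivative: chord slopes from b decrease in v, so their supremum is the limit as v
    decreases to b. *)
Let right_slope b := sup [set slope b v | v in [set v | b < v]].

Let right_slope_has_sup b : 0 < b -> has_sup [set slope b v | v in [set v | b < v]].
Proof.
move=> b0; split.
  by exists (slope b (b + 1)), (b + 1) => //=; rewrite ltrDl.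
exists (slope (b / 2) b) => _ [v /= bv <-]; apply: slope_le => //; lra.
Qed.

Let right_slope_ge b v : 0 < b -> b < v -> slope b v <= right_slope b.
Proof. by move=> b0 bv; apply: sup_upper_bound; [exact: right_slope_has_sup|exists v]. Qed.

Let right_slope_le b u : 0 < u -> u < b -> right_slope b <= slope u b.
Proof.
move=> u0 ub; apply: ge_sup; first by case: (right_slope_has_sup (lt_trans u0 ub)).
by move=> _ [v /= bv <-]; exact: slope_le.
Qed.

Lemma ex_supporting_slopes : exists s : R -> R,
  [/\ forall b, 0 < b -> 0 <= s b,
      forall a b, 0 < a -> a <= b -> s b <= s a
    & forall a b, 0 < a -> 0 < b -> f a <= f b + s b * (a - b)].
Proof.
exists right_slope; split.
- move=> b b0; have bb : b < b + 1 by lra.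
  apply: le_trans (right_slope_ge b0 bb); rewrite /slope addrAC subrr add0r divr1 subr_ge0.
  exact: f_mono (ltW bb).
- move=> a b a0; rewrite le_eqVlt => /orP[/eqP -> //|ab].
  by apply: (@le_trans _ _ (slope a b)); [exact: right_slope_le|exact: right_slope_ge].
- move=> a b a0 b0; case: (ltgtP a b) => [ab|ba|->]; last by rewrite subrr mulr0 addr0.
  + have := right_slope_le a0 ab; rewrite /slope ler_pdivlMr ?subr_gt0 //; lra.
  + have := right_slope_ge b0 ba; rewrite /slope ler_pdivrMr ?subr_gt0 //; lra.
Qed.

(** If the line at b touched the graph again at a, strict concavity would put the graph above the
    line at their midpoint. *)
Lemma supporting_slopes_strict (s : R -> R) :
  (forall x y a, 0 < x -> 0 < y -> x != y -> 0 < a -> a < 1 ->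
     a * f x + (1 - a) * f y < f (a * x + (1 - a) * y)) ->
  (forall a b, 0 < a -> 0 < b -> f a <= f b + s b * (a - b)) ->
  forall a b, 0 < a -> 0 < b -> a != b -> f a < f b + s b * (a - b).
Proof.
move=> f_strict sup a b a0 b0 ab; rewrite lt_neqAle sup // andbT; apply/eqP => fab.
have h0 : 0 < 2^-1 :> R by rewrite invr_gt0.
have h1 : 2^-1 < 1 :> R by rewrite invf_lt1 // ltr1n.
have := f_strict a b 2^-1 a0 b0 ab h0 h1.
have m0 : 0 < 2^-1 * a + (1 - 2^-1) * b by lra.
have := sup _ b m0 b0; lra.
Qed.

(** On the half-line from [b / 2] all slopes are at most [s (b / 2)], so f is Lipschitz there;
    adding 1 keeps the divisor positive. *)
Lemma supporting_slopes_continuous (s : R -> R) :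
  (forall b, 0 < b -> 0 <= s b) -> (forall a b, 0 < a -> a <= b -> s b <= s a) ->
  (forall a b, 0 < a -> 0 < b -> f a <= f b + s b * (a - b)) ->
  forall b, 0 < b -> {for b, continuous f}.
Proof.
move=> s0 sdec sup b b0; have b20 : 0 < b / 2 by lra.
apply/cvgrPdist_le => e e0.
have c0 : 0 < s (b / 2) + 1 by have := s0 _ b20; lra.
have d0 : 0 < Num.min (b / 2) (e / (s (b / 2) + 1)) by rewrite lt_min b20 divr_gt0.
near=> a.
have : `|b - a| < Num.min (b / 2) (e / (s (b / 2) + 1)).
  by near: a; exists (Num.min (b / 2) (e / (s (b / 2) + 1))).
rewrite lt_min => /andP[ab]; rewrite ltr_pdivlMr // => abe.
have a2 : b / 2 <= a by have := ler_norm (b - a); lra.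
have a0 : 0 < a by lra.
have sa : s a <= s (b / 2) by exact: sdec.
have sb : s b <= s (b / 2) by apply: sdec => //; lra.
have sa0 := s0 a a0; have sb0 := s0 b b0.
have h1 := sup a b a0 b0; have h2 := sup b a b0 a0.
have n1 := ler_norm (b - a); have n2 := ler_norm (- (b - a)); rewrite normrN in n2.
rewrite ler_norml; apply/andP; split.
- have : s b * (a - b) <= (s (b / 2) + 1) * `|b - a|.
    apply: (@le_trans _ _ (s b * `|b - a|)); first by rewrite ler_wpM2l //; lra.
    by rewrite ler_wpM2r //; lra.
  by rewrite mulrC in abe; lra.
- have : s a * (b - a) <= (s (b / 2) + 1) * `|b - a|.
    apply: (@le_trans _ _ (s a * `|b - a|)); first by rewrite ler_wpM2l //; lra.
    by rewrite ler_wpM2r //; lra.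
  by rewrite mulrC in abe; lra.
Unshelve. all: by end_near. Qed.

(** The case [a = 0] is the limit of positive [a]. A real d strictly between the two sides is
    contradicted at a small t, which covers extended values of [h 0]. *)
Lemma supporting_at0 (h : R -> \bar R) (s : R -> R) :
  (forall b, 0 < b -> 0 <= s b) -> (forall a b, 0 < a -> a <= b -> s b <= s a) ->
  (forall a b, 0 < a -> 0 < b -> f a <= f b + s b * (a - b)) ->
  (forall t, 0 < t -> h t = (f t)%:E) -> h t @[t --> 0^'+] --> h 0 ->
  supporting h s.
Proof.
move=> s0 sdec sup hE h0; split=> // a b; rewrite le_eqVlt => /orP[/eqP <-|a0] b0; last first.
  by rewrite !hE // lee_fin sup.
rewrite (hE b b0) -EFinD sub0r leNgt; apply/negP => /lte_exists_between[d Md dh].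
have c0 : 0 < s b + 1 by have := s0 _ b0; lra.
have e0 : 0 < (d - (f b + s b * - b)) / (s b + 1) by rewrite divr_gt0 //; lra.
have nd : \forall t \near 0^'+, (d%:E < h t)%E by exact: cvge_near_gt dh.
near (0 : R)^'+ => t.
have dt : (d%:E < h t)%E by near: t.
have t0 : 0 < t by near: t; exact: nbhs_right_gt.
have te : t < (d - (f b + s b * - b)) / (s b + 1) by near: t; exact: nbhs_right_lt.
move: dt te; rewrite (hE t t0) lte_fin ltr_pdivlMr // => dt te.
have := sup t b t0 b0; rewrite mulrBr; lra.
Unshelve. all: by end_near. Qed.

End Slopes.

Section KernelSlopes.
Variables (R : realType) (K : R -> R).
Hypothesis hK : kernel_function K.
Hypothesis hKmon : monotone_kernel K.

Lemma concave_onP (D : set R) (f : R -> R) : concave_on D f ->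
  forall x y a, D x -> D y -> 0 <= a -> a <= 1 ->
    a * f x + (1 - a) * f y <= f (a * x + (1 - a) * y).
Proof.
move=> fD x y a Dx Dy a0 a1.
have : - f (a * x + (1 - a) * y) <= a * - f x + (1 - a) * - f y.
  exact: (fD (Itv01 a0 a1) x y (mem_set Dx) (mem_set Dy)).
by rewrite !mulrN -opprD lerN2.
Qed.

(** The equal one-sided limits form a limit on the punctured neighbourhood, so the [lim] in
    [kernel0] is a genuine limit. *)
Lemma kernel0_cvg : (K t)%:E @[t --> 0^'+] --> kernel0 K /\
  (K t)%:E @[t --> 0^'-] --> kernel0 K /\ kernel0 K != +oo%E.
Proof.
case: hK => _ _ [l [lNy lr ll]].
suff -> : kernel0 K = l by [].
apply: cvg_lim => // A lA.
have nr : \forall t \near (0 : R), 0 < t -> A (K t)%:E by exact: lr.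
have nl : \forall t \near (0 : R), t < 0 -> A (K t)%:E by exact: ll.
suff : \forall t \near (0 : R), t != 0 -> A (K t)%:E by [].
by apply: filterS2 nr nl => t rt lt; rewrite neq_lt => /orP[]; [exact: lt|exact: rt].
Qed.

Lemma ext_kernel_neq0 t : t != 0 -> ext_kernel K t = (K t)%:E.
Proof. by move=> t0; rewrite /ext_kernel (negbTE t0). Qed.

Let fpos_mono x y : 0 < x -> x <= y -> K x <= K y.
Proof. by case: hKmon => _; apply. Qed.

Let fneg_mono x y : 0 < x -> x <= y -> K (- x) <= K (- y).
Proof. by move=> x0 xy; case: hKmon => + _; apply; rewrite ?lerN2 // oppr_lt0. Qed.

Let fpos_conc x y a : 0 < x -> 0 < y -> 0 <= a -> a <= 1 ->
  a * K x + (1 - a) * K y <= K (a * x + (1 - a) * y).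
Proof.
case: hK => _ + _ => /concave_onP hc x0 y0; apply: hc; rewrite /= in_itv /= andbT //.
Qed.

Let fneg_conc x y a : 0 < x -> 0 < y -> 0 <= a -> a <= 1 ->
  a * K (- x) + (1 - a) * K (- y) <= K (- (a * x + (1 - a) * y)).
Proof.
case: hK => + _ _ => /concave_onP hc x0 y0 a0 a1.
rewrite opprD -!mulrN; apply: hc => //; rewrite /= in_itv /= oppr_lt0 //.
Qed.

Lemma ext_kernel_at_right0 : ext_kernel K t @[t --> 0^'+] --> ext_kernel K 0.
Proof.
rewrite {2}/ext_kernel eqxx; have [lr _] := kernel0_cvg.
apply: cvg_trans lr; apply: near_eq_cvg; near=> t; rewrite ext_kernel_neq0 // gt_eqF //.
Unshelve. all: by end_near. Qed.

Lemma ext_kernel_at_left0 : ext_kernel K t @[t --> 0^'-] --> ext_kernel K 0.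
Proof.
rewrite {2}/ext_kernel eqxx; have [_ [ll _]] := kernel0_cvg.
apply: cvg_trans ll; apply: near_eq_cvg; near=> t; rewrite ext_kernel_neq0 // lt_eqF //.
Unshelve. all: by end_near. Qed.

Lemma kernel_continuous_neq0 t : t != 0 -> {for t, continuous K}.
Proof.
rewrite neq_lt => /orP[t0|t0]; last first.
  have [s [s0 sdec sup]] := ex_supporting_slopes fpos_mono fpos_conc.
  exact: supporting_slopes_continuous s0 sdec sup _ t0.
have [s [s0 sdec sup]] := ex_supporting_slopes fneg_mono fneg_conc.
have Nt0 : 0 < - t by rewrite oppr_gt0.
have := supporting_slopes_continuous s0 sdec sup Nt0 => c.
have -> : K = (fun u => K (- u)) \o -%R by apply/funext => u /=; rewrite opprK.
by apply: continuous_comp; [exact: opp_continuous|exact: c].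
Qed.

Lemma ext_kernel_continuous : continuous (ext_kernel K).
Proof.
move=> t; have [->|t0] := eqVneq t 0.
  move=> A lA.
  have nr : \forall t \near (0 : R), 0 < t -> A (ext_kernel K t) by exact: ext_kernel_at_right0.
  have nl : \forall t \near (0 : R), t < 0 -> A (ext_kernel K t) by exact: ext_kernel_at_left0.
  apply: filterS2 nr nl => u ru lu; case: (ltgtP u 0) => [|| ->]; [exact: lu|exact: ru|].
  exact: (nbhs_singleton lA).
rewrite /continuous_at ext_kernel_neq0 //.
have KE : (K u)%:E @[u --> t] --> (K t)%:E.
  by apply: cvg_EFin; [exact: nearW|exact: kernel_continuous_neq0].
apply: cvg_trans KE; apply: near_eq_cvg.
have nt : \forall u \near t, u != 0.
  by apply: (@open_nbhs_nbhs _ t [set u | u != 0]); split => //; exact: open_neq.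
by apply: filterS nt => u u0; rewrite ext_kernel_neq0.
Qed.

(** Strictness at [a = 0] comes from singularity, as -oo lies below every real; at positive [a] it
    comes from strict concavity. *)
Lemma ext_kernel_slopes : exists sp sn, kernel_slopes (ext_kernel K) sp sn /\
  (singular_kernel K -> strictly_concave_kernel K ->
   strictly_supporting (ext_kernel K) sp /\ strictly_supporting (fun t => ext_kernel K (- t)) sn).
Proof.
have [sp [sp0 spdec spsup]] := ex_supporting_slopes fpos_mono fpos_conc.
have [sn [sn0 sndec snsup]] := ex_supporting_slopes fneg_mono fneg_conc.
have posE t : 0 < t -> ext_kernel K t = (K t)%:E by move=> t0; rewrite ext_kernel_neq0 // gt_eqF.
have negE t : 0 < t -> ext_kernel K (- t) = (K (- t))%:E.
  by move=> t0; rewrite ext_kernel_neq0 // oppr_eq0 gt_eqF.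
exists sp, sn; split; first split.
- exact: ext_kernel_continuous.
- by move=> t t0; rewrite ext_kernel_neq0.
- move=> t; rewrite /ext_kernel; case: eqP => _; last by rewrite ltry.
  by rewrite ltey; case: kernel0_cvg => _ [].
- exact: supporting_at0 sp0 spdec spsup posE ext_kernel_at_right0.
- apply: supporting_at0 sn0 sndec snsup negE _; rewrite oppr0.
  apply/cvg_at_rightNP; rewrite oppr0.
  have -> : (fun t => ext_kernel K (- t)) \o -%R = ext_kernel K.
    by apply/funext => t /=; rewrite opprK.
  exact: ext_kernel_at_left0.
- move=> K0 [Kn Kp].
  have ext0 : ext_kernel K 0 = -oo%E by rewrite /ext_kernel eqxx.
  split=> a b; rewrite le_eqVlt => /orP[/eqP <-|a0] b0 ab.
  + by rewrite ext0 posE // -EFinD ltNyr.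
  + rewrite !posE // -EFinD lte_fin; apply: (supporting_slopes_strict _ spsup) => //.
    by move=> x y c x0 y0; apply: Kp; rewrite /= in_itv /= andbT.
  + by rewrite oppr0 ext0 negE // -EFinD ltNyr.
  + rewrite !negE // -EFinD lte_fin; apply: (supporting_slopes_strict _ snsup) => //.
    move=> x y c x0 y0 xy c0 c1; rewrite opprD -!mulrN.
    by apply: Kn => //; rewrite /= ?in_itv /= ?oppr_lt0 // eqr_opp.
Qed.

End KernelSlopes.

(** * Semicontinuity and admissibility of the given field *)

Lemma upper_semicontinuous_usc_at (R : realType) (J : R -> \bar R) :
  upper_semicontinuous J -> usc_at J.
Proof.
move=> Jusc t a Ja; have [|V tV h] := Jusc t (- a).
  by rewrite EFinN lteN2.
by apply: filterS tV => s /h; rewrite EFinN lteN2.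
Qed.

Lemma field_function_bounds (R : realType) (n : nat) (rho : R) (K : R -> R) (J : R -> \bar R) :
  field_function n J -> admissible rho K J -> field_bounds n rho (ext_kernel K) J.
Proof.
move=> [ub [s [us ns sfin]]] [adml admr]; split=> //.
- move=> A; have := (cvgeNyPle _).1 adml A; have := (cvgeNyPle _).1 admr A.
  (* The threshold lies strictly beyond both one-sided ones, as neighbourhoods of infinity are given
     by strict inequalities. *)
  move=> [T1 [_ hT1]] [T2 [_ hT2]]; exists (`|T1| + `|T2| + 1) => t tT.
  have n1 := ler_norm T1; have n2 := ler_norm (- T2); rewrite normrN in n2.
  have m1 := normr_ge0 T1; have m2 := normr_ge0 T2.
  have [t0|t0] := leP 0 t.
    rewrite (ger0_norm t0) in tT; apply: hT1; lra.
  rewrite (ltr0_norm t0) in tT; apply: hT2; lra.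
- pose l := sort <=%R s; exists (nth 0 l) => [i ltin|i ltin].
    have ssize : size l = size s by rewrite size_sort.
    have lsorted : sorted <%R l by rewrite sort_lt_sorted.
    by move/sortedP : lsorted => /(_ 0); apply; rewrite ssize; apply: leq_trans ns.
  by apply: sfin; rewrite -(mem_sort <=%R) mem_nth // size_sort; apply: leq_ltn_trans ns.
Qed.

(** * Strict comparison of local maxima *)

Section StrictComparison.
Variables (R : realType) (n : nat) (r : nat -> R) (k : R -> \bar R) (sp sn : R -> R).
Variable J : R -> \bar R.
Hypothesis r_gt0 : forall i, 0 < r i.
Hypothesis kS : kernel_slopes k sp sn.
Hypothesis fB : field_bounds n (\sum_(i < n) r i) k J.

Lemma le_sum_norm (y : nat -> R) i : (i < n)%N -> `|y i| <= \sum_(l < n) `|y l|.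
Proof. by move=> ltin; rewrite (bigD1 (Ordinal ltin)) //= lerDl; apply: sumr_ge0. Qed.

Lemma imax_lty y j : (imax n r k J y j < +oo)%E.
Proof.
have [A h] := tsum_bounded r_gt0 kS fB (\sum_(l < n) `|y l|).
apply: (@le_lt_trans _ _ A%:E); last by rewrite ltry.
by apply: ge_ereal_sup => _ [t _ <-]; apply: h => i; exact: le_sum_norm.
Qed.

Hypothesis Jusc : usc_at J.

(** This is [tsum_limit] for a constant sequence of nodes. *)
Lemma imax_attained y j : (j <= n)%N -> imax n r k J y j \is a fin_num ->
  exists2 t, ncell n y j t & (imax n r k J y j <= tsum n r k J y t)%E.
Proof.
move=> jn fin; have [U UU ooU] := ultra_oo.
have h0 m : 0 < harmonic m :> R by exact: harmonic_gt0.
have ex_t m : exists2 t, ncell n y j t &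
    ((fine (imax n r k J y j) - harmonic m)%:E <= tsum n r k J y t)%E.
  have [|t tc tF] := @imax_gtP _ n r k J y j (fine (imax n r k J y j) - harmonic m)%:E.
    by rewrite -{2}(fineK fin) lte_fin; have := h0 m; lra.
  by exists t => //; exact: ltW.
pose s m := s2val (cid2 (ex_t m)); rewrite -{1}(fineK fin).
apply: (@tsum_limit _ _ _ _ _ _ _ r_gt0 kS fB Jusc U UU (fun=> y) y (\sum_(l < n) `|y l|) _ harmonic s) => //.
- by move=> m i; exact: le_sum_norm.
- by move=> i _; exact: cvg_cst.
- by apply: cvg_trans (@cvg_harmonic R) => A; exact: ooU.
- by move=> m; rewrite /s; case: cid2.
- by move=> m; rewrite /s; case: cid2.
Qed.

(** The pointwise strict inequality survives the supremum because it is applied at a point attaining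
    the local maximum of [x]. *)
Lemma ex_imax_lt x y (i : 'I_n) : strictly_supporting k sp ->
  strictly_supporting (fun t => k (- t)) sn ->
  nondecr_upto n x -> nondecr_upto n y -> x i != y i ->
  (forall j, (j <= n)%N -> imax n r k J x j \is a fin_num) ->
  exists2 j, (j <= n)%N & (imax n r k J x j < imax n r k J y j)%E.
Proof.
move=> kps kns xs ys xyi xfin; have [j jm] := ex_wshift_argmax n r x y.
have [jn _] := jm; exists j => //; have [t tc tF] := imax_attained jn (xfin j jn).
apply: (@lt_le_trans _ _ (tsum n r k J y t)); last exact: imax_ge (argmax_cell r_gt0 jm tc).
apply: (le_lt_trans tF).
have : tsum n r k J x t \is a fin_num.
  rewrite fin_numElt (tsum_lty r_gt0 kS fB) andbT; apply: lt_le_trans tF.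
  by have := xfin j jn; rewrite fin_numElt => /andP[].
rewrite fin_numD => /andP[Jfin pfin]; rewrite /tsum lteD2lE //.
exact: (argmax_psum_lt r_gt0 xs ys jm tc (ks_pos kS) (ks_neg kS) kps kns xyi pfin).
Qed.

End StrictComparison.

(** * Passage between tuples and sequences of nodes *)

Section Tuples.
Variables (R : realType) (n : nat).

Lemma Sbar_nondecr (y : n.-tuple R) : Sbar y <-> nondecr_upto n (nth 0 y).
Proof.
split=> [ys|ys].
  by apply: nondecr_uptoP => i iln; move/(sortedP 0) : ys; apply; rewrite size_tuple.
by apply/(sortedP 0) => i; rewrite size_tuple => iln; exact: ys.
Qed.

Lemma nth_mktuple_ord (w : nat -> R) i : (i < n)%N -> nth 0 [tuple w l | l < n] i = w i.
Proof. by move=> ltin; rewrite (nth_mktuple (fun l : 'I_n => w l) 0 (Ordinal ltin)). Qed.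

Lemma eq_imax (r : nat -> R) (k J : R -> \bar R) (x y : nat -> R) j :
  (j <= n)%N -> (forall i, (i < n)%N -> x i = y i) -> imax n r k J x j = imax n r k J y j.
Proof.
move=> jn xy; rewrite /imax; congr ereal_sup.
have -> : ncell n x j = ncell n y j.
  apply/seteqP; split=> t [tl tr]; split.
  - by move=> j0; rewrite -xy ?tl // prednK.
  - by move=> ltjn; rewrite -xy ?tr.
  - by move=> j0; rewrite xy ?tl // prednK.
  - by move=> ltjn; rewrite xy ?tr.
apply: eq_imagel => t _; rewrite /tsum /psum; congr (_ + _)%E.
by apply: eq_bigr => i _; rewrite xy.
Qed.

Lemma int_max_imax (K : R -> R) (r : nat -> R) (J : R -> \bar R) (y : n.-tuple R) j :
  int_max K (fun i : 'I_n => r i) J y j = imax n r (ext_kernel K) J (nth 0 y) j.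
Proof.
rewrite /int_max /imax; congr ereal_sup; apply: eq_imagel => t _.
rewrite /sum_of_translates /tsum /psum; congr (_ + _)%E.
by apply: eq_bigr => i _; rewrite (tnth_nth 0).
Qed.

Lemma ex_nat_extension (r : 'I_n -> R) : (forall i, 0 < r i) ->
  exists2 s : nat -> R, forall i, 0 < s i & r = (fun i : 'I_n => s i).
Proof.
move=> r0; exists (fun i => if insub i is Some l then r l else 1).
  by move=> i; case: insubP.
by apply/funext => i; rewrite valK.
Qed.

Lemma tuple_neq (x y : n.-tuple R) : x <> y -> exists i : 'I_n, nth 0 x i != nth 0 y i.
Proof.
move=> xy; apply: contrapT => h; apply: xy; apply: eq_from_tnth => i.
by apply/eqP/negPn/negP; rewrite !(tnth_nth 0) => e; apply: h; exists i.
Qed.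

End Tuples.

(** * Equality of the two values, equioscillation and uniqueness *)

Theorem theorem1p1 (R : realType) (K : R -> R) (n : nat) (r : 'I_n -> R)
    (J : R -> \bar R)
    (hK : kernel_function K) (hKmon : monotone_kernel K)
    (hn : (0 < n)%N) (hr : forall i, 0 < r i)
    (hJ : field_function n J)
    (hadm : admissible (\sum_(i < n) r i) K J) :
  minimax_value K r J = maximin_value K r J /\
  (exists w : n.-tuple R, Sbar w /\ max_max K r J w = minimax_value K r J) /\
  (~ exists x y : n.-tuple R,
      [/\ Sbar x, Sbar y, int_max_finite K r J x, int_max_finite K r J y
        & forall j : 'I_n.+1, (int_max K r J x j > int_max K r J y j)%E]) /\
  (forall e : n.-tuple R, equioscillation_point K r J e ->
      [/\ minimax_value K r J = max_max K r J e,
          max_max K r J e = min_max K r J e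
        & min_max K r J e = maximin_value K r J]) /\
  (upper_semicontinuous J \/ singular_kernel K ->
      exists e : n.-tuple R, equioscillation_point K r J e) /\
  (singular_kernel K -> strictly_concave_kernel K ->
      [/\ exists! e : n.-tuple R, equioscillation_point K r J e,
          ~ exists x y : n.-tuple R,
            [/\ Sbar x /\ Sbar y, x <> y,
                int_max_finite K r J x, int_max_finite K r J y
              & forall j : 'I_n.+1, (int_max K r J x j >= int_max K r J y j)%E]
        & forall e : n.-tuple R, equioscillation_point K r J e ->
            unique (minimax_point K r J) e /\
            unique (maximin_point K r J) e]).
Proof.
have [s s_gt0 rE] := ex_nat_extension hr; subst r.
have [sp [sn [kS kstrict]]] := ext_kernel_slopes hK hKmon.
have fB := field_function_bounds hJ hadm.
pose m := imax n s (ext_kernel K) J.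
pose im (y : n.-tuple R) (j : 'I_n.+1) := int_max K (fun i : 'I_n => s i) J y j.
pose equi := equioscillation_point K (fun i : 'I_n => s i) J.
have mE (y : n.-tuple R) j : int_max K (fun i : 'I_n => s i) J y j = m (nth 0%R y) j.
  exact: int_max_imax.
have tupleP (w : nat -> R) j : (j <= n)%N -> m (nth 0%R [tuple w i | i < n]) j = m w j.
  by move=> jn; apply: eq_imax => // i; exact: nth_mktuple_ord.
have tuple_sorted (w : nat -> R) : nondecr_upto n w -> Sbar [tuple w i | i < n].
  move=> ws; apply/Sbar_nondecr => i j ij jn.
  by rewrite !nth_mktuple_ord ?(leq_ltn_trans ij jn) //; exact: ws.
pose MM := max_max K (fun i : 'I_n => s i) J; pose Mm := min_max K (fun i : 'I_n => s i) J.
pose V := minimax_value K (fun i : 'I_n => s i) J.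
pose W := maximin_value K (fun i : 'I_n => s i) J.
have MM_le (y : n.-tuple R) (c : \bar R) :
    (forall j, (j <= n)%N -> (m (nth 0%R y) j <= c)%E) -> (MM y <= c)%E.
  by move=> yc; apply: bigmax_le => [|j _]; [exact: leNye|rewrite mE yc // -ltnS].
have Mm_ge (y : n.-tuple R) (c : \bar R) :
    (forall j, (j <= n)%N -> (c <= m (nth 0%R y) j)%E) -> (c <= Mm y)%E.
  by move=> yc; apply: le_bigmin => [|j _]; [exact: leey|rewrite mE yc // -ltnS].
have MM_ge (y : n.-tuple R) j : (j <= n)%N -> (m (nth 0%R y) j <= MM y)%E.
  move=> jn; have jn1 : (j < n.+1)%N by [].
  by rewrite -mE; exact: (le_bigmax _ (im y) (Ordinal jn1)).
have Mm_le (y : n.-tuple R) j : (j <= n)%N -> (Mm y <= m (nth 0%R y) j)%E.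
  move=> jn; have jn1 : (j < n.+1)%N by [].
  by rewrite -mE; exact: (bigmin_le_cond _ (im y) (j := Ordinal jn1)).
have cmp (x y : n.-tuple R) : Sbar x -> Sbar y ->
    exists2 j, (j <= n)%N & (m (nth 0%R x) j <= m (nth 0%R y) j)%E.
  by move=> /Sbar_nondecr xs /Sbar_nondecr ys; exact: (ex_imax_le J s_gt0 kS xs ys).
have V_le y : Sbar y -> (V <= MM y)%E by move=> ys; apply: ereal_inf_lbound; exists y.
have W_ge y : Sbar y -> (Mm y <= W)%E by move=> ys; apply: ereal_sup_ubound; exists y.
have WV : (W <= V)%E.
  apply: ge_ereal_sup => _ [x xs <-]; apply: le_ereal_inf_tmp => _ [y ys <-].
  have [j jn h] := cmp x y xs ys.
  exact: le_trans (Mm_le x j jn) (le_trans h (MM_ge y j jn)).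
(* An equioscillation point for the envelope supplies the common value [mu]. The envelope only
   raises local maxima, so [V <= mu]; moving the nodes with [level_usc_env] gives [mu <= W]. *)
have fBu := usc_env_field_bounds s_gt0 hn kS fB.
have [mu [w [ws wmu]]] := ex_equioscillation s_gt0 hn kS fBu (@usc_env_usc _ J).
pose wt := [tuple w i | i < n].
have wts : Sbar wt := tuple_sorted w ws.
have MMw : (MM wt <= mu%:E)%E.
  apply: MM_le => j jn; rewrite tupleP //; apply: le_trans (imax_usc_env_ge _ _ _ _ _ _) _.
  by rewrite wmu.
have muW : (mu%:E <= W)%E.
  rewrite leNgt; apply/negP => /lte_exists_below[c Wc cmu].
  have [|y ys yc] := level_usc_env s_gt0 hn kS fB ws wmu (c := (c + mu) / 2); first lra.
  have : (((c + mu) / 2)%:E <= W)%E.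
    apply: le_trans (W_ge _ (tuple_sorted y ys)); apply: Mm_ge => j jn.
    by rewrite tupleP // yc.
  by move=> /le_trans /(_ Wc); rewrite lee_fin; lra.
have Vmu : V = mu%:E.
  by apply/le_anti; rewrite (le_trans (V_le _ wts) MMw) (le_trans muW WV).
have Wmu : W = mu%:E by apply/le_anti; rewrite muW andbT -Vmu WV.
have equiE (e : n.-tuple R) j : equi e -> (j <= n)%N ->
    m (nth 0%R e) j = MM e /\ m (nth 0%R e) j = Mm e.
  move=> [es eq] jn; have jn1 : (j < n.+1)%N by [].
  have cst l : (l <= n)%N -> m (nth 0%R e) l = m (nth 0%R e) j.
    move=> ln; have ln1 : (l < n.+1)%N by [].
    by rewrite -!mE; exact: (eq (Ordinal ln1) (Ordinal jn1)).
  split; apply/le_anti.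
    by rewrite MM_ge // MM_le // => l ln; rewrite cst.
  by rewrite Mm_le // Mm_ge // => l ln; rewrite cst.
(* The chain [mu = V <= MM e = Mm e <= W = mu] collapses. *)
have equi_val e : equi e -> MM e = mu%:E /\ Mm e = mu%:E.
  move=> ee; have [h1 h2] := equiE e 0%N ee (leq0n n); have [es _] := ee.
  have h3 : MM e = Mm e by rewrite -h1 -h2.
  have h4 : (mu%:E <= MM e)%E by rewrite -Vmu V_le.
  have h5 : (Mm e <= mu%:E)%E by rewrite -Wmu W_ge.
  by rewrite -h3; rewrite -h3 in h5; split; apply/le_anti; rewrite h4 h5.
have imax_env (y : n.-tuple R) j : singular_kernel K -> Sbar y -> (j <= n)%N ->
    imax n s (ext_kernel K) (usc_env J) (nth 0%R y) j = m (nth 0%R y) j.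
  move=> K0 /Sbar_nondecr ys jn; apply: (imax_usc_env s_gt0 hn kS fB _ ys jn).
  by rewrite /ext_kernel eqxx.
have ex_equi : upper_semicontinuous J \/ singular_kernel K ->
    exists e, equi e.
  move=> [Jusc|K0].
    have [nu [v [vs vnu]]] := ex_equioscillation s_gt0 hn kS fB (upper_semicontinuous_usc_at Jusc).
    exists [tuple v i | i < n]; split; first exact: tuple_sorted.
    have vtnu j : (j <= n)%N -> m (nth 0%R [tuple v i | i < n]) j = nu%:E.
      by move=> jn; rewrite tupleP //; exact: vnu.
    by move=> i j; rewrite (mE _ i) (mE _ j) !vtnu // -ltnS.
  have wtmu j : (j <= n)%N -> m (nth 0%R wt) j = mu%:E.
    move=> jn; rewrite -(imax_env wt j K0 wts jn) -(wmu j jn); apply: eq_imax => // i.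
    exact: nth_mktuple_ord.
  by exists wt; split=> // i j; rewrite (mE _ i) (mE _ j) !wtmu // -ltnS.
(* The strict comparison needs attained maxima, so it is applied to the envelope, which has the same
   local maxima when K is singular. *)
have strict (x y : n.-tuple R) : singular_kernel K -> strictly_concave_kernel K ->
    Sbar x -> Sbar y -> x <> y -> (forall j, (j <= n)%N -> m (nth 0%R x) j \is a fin_num) ->
    exists2 j, (j <= n)%N & (m (nth 0%R x) j < m (nth 0%R y) j)%E.
  move=> K0 Kstrict xs ys /tuple_neq[i xyi] xfin; have [kps kns] := kstrict K0 Kstrict.
  have xs' := (Sbar_nondecr x).1 xs; have ys' := (Sbar_nondecr y).1 ys.
  have [|j jn h] := ex_imax_lt s_gt0 kS fBu (@usc_env_usc _ J) kps kns xs' ys' xyi.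
    by move=> j jn; rewrite (imax_env x j K0 xs jn); exact: xfin.
  by exists j => //; rewrite -(imax_env x j K0 xs jn) -(imax_env y j K0 ys jn).
split; first by rewrite -/V -/W Vmu Wmu.
split.
  exists wt; split=> //; rewrite -/MM -/V; apply/le_anti.
  by rewrite V_le // andbT Vmu.
split.
  move=> [x [y [xs ys _ _ lt_yx]]]; have [j jn] := cmp x y xs ys.
  have jn1 : (j < n.+1)%N by [].
  by apply/negP; rewrite -ltNge -!mE; exact: (lt_yx (Ordinal jn1)).
split.
  move=> e /equi_val[eM em]; rewrite -/V -/W -/MM -/Mm.
  by rewrite eM em Vmu Wmu.
split; first exact: ex_equi.
move=> K0 Kstrict.
have equi_fin (e : n.-tuple R) j : equi e -> (j <= n)%N ->
    m (nth 0%R e) j = mu%:E.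
  by move=> ee jn; have [-> _] := equiE e j ee jn; case: (equi_val e ee).
split.
- have [e ee] := ex_equi (or_intror K0); exists e; split=> // e' ee'.
  apply: contrapT => ee'N; have [es _] := ee; have [es' _] := ee'.
  have [|j jn] := strict e e' K0 Kstrict es es' ee'N.
    by move=> j jn; rewrite equi_fin.
  by rewrite !equi_fin // ltxx.
- move=> [x [y [[xs ys] xy xfin _ le_yx]]].
  have [|j jn] := strict x y K0 Kstrict xs ys xy.
    move=> j jn; have jn1 : (j < n.+1)%N by [].
    by rewrite -mE; exact: (xfin (Ordinal jn1)).
  have jn1 : (j < n.+1)%N by [].
  by apply/negP; rewrite -leNgt -!mE; exact: (le_yx (Ordinal jn1)).
- move=> e ee; have [eM em] := equi_val e ee; have [es _] := ee.
  split; split.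
  + by split=> //; rewrite -/MM -/V eM.
  (* Another minimax point would have some local maximum above that of [e], which is already
     [mu]. *)
  + move=> y [ys yV]; apply: contrapT => ey.
    have [|j jn] := strict e y K0 Kstrict es ys ey.
      by move=> j jn; rewrite equi_fin.
    apply/negP; rewrite -leNgt (equi_fin e j ee jn) -Vmu /V -yV; exact: MM_ge.
  + by split=> //; rewrite -/Mm -/W em.
  (* Here [y] comes first in the strict comparison; its local maxima are finite because they are at
     least [mu]. *)
  + move=> y [ys yW]; apply: contrapT => ey.
    have ymu j : (j <= n)%N -> (mu%:E <= m (nth 0%R y) j)%E.
      by move=> jn; rewrite -Wmu /W -yW; exact: Mm_le.
    have [||j jn] := strict y e K0 Kstrict ys es.
    * by move=> ye; apply: ey.
    * move=> j jn; rewrite fin_numElt (imax_lty s_gt0 kS fB) andbT.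
      by apply: lt_le_trans (ymu j jn); rewrite ltNyr.
    * by apply/negP; rewrite -leNgt (equi_fin e j ee jn) ymu.
Qed.
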